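(* For every $m\ge 0$ and all $f_0,f_1,\dots,f_m\in\mathcal A=\mathbb C[x^1,\dots,x^r,p_1,\dots,p_r]$, $$\sigma^\hbar\big(b(f_0\otimes f_1\otimes\cdots\otimes f_m)\big)=i\hbar\,\Delta\big(\sigma^\hbar(f_0\otimes f_1\otimes\cdots\otimes f_m)\big),$$ where $\sigma^\hbar$ is the quantum HKR map, $b$ is the Hochschild differential with respect to the Moyal product $*$ (with $b=0$ on $0$-chains), and $\Delta=\sum_{i=1}^r\left(\frac{\partial}{\partial x^i}\iota_{\partial_{p_i}}-\frac{\partial}{\partial p_i}\iota_{\partial_{x^i}}\right)$ (with $\Delta=0$ on $0$-forms).
   Context: Let $\mathcal A=\mathbb C[x^1,\dots,x^r,p_1,\dots,p_r]$, with $\hbar$ a formal variable, and let $\Omega^m_{\mathcal A}$ be the space of algebraic (polynomial) differential $m$-forms in the variables $x^i,p_i$. Moyal product: on $\mathcal A[\hbar]$, $f*g$ is the $\mathbb C[\hbar]$-bilinear associative product $f*g=f\exp\!\Big(\frac{i\hbar}{2}\sum_{j=1}^r\big(\overleftarrow{\partial}_{x^j}\overrightarrow{\partial}_{p_j}-\overleftarrow{\partial}_{p_j}\overrightarrow{\partial}_{x^j}\big)\Big)g$, where left (right) arrows mean that the derivative acts on $f$ (on $g$). The Weyl algebra is $\mathcal A^\hbar=(\mathcal A[\hbar],* )$. Hochschild differential: on $m$-chains (the $(m+1)$-fold tensor power of $\mathcal A^\hbar$ over $\mathbb C[\hbar]$, i.e. $\mathcal A^{\otimes(m+1)}[\hbar]$),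 for $m\ge1$, $$b(a_0\otimes\cdots\otimes a_m)=\sum_{k=0}^{m-1}(-1)^k a_0\otimes\cdots\otimes a_k*a_{k+1}\otimes\cdots\otimes a_m+(-1)^m\,a_m*a_0\otimes a_1\otimes\cdots\otimes a_{m-1}.$$ Green's function: $G$ on $S^1\times S^1$, $S^1=\mathbb R/\mathbb Z$, is defined by choosing representatives with $0\le s-t<1$ and setting $G(t,s)=s-t-\frac12$ if $0<s-t<1$, and $G(t,s)=0$ if $s=t$. Configuration space: $\mathrm{Cyc}_{m+1}(S^1)$ is the set of $(\theta_0,\dots,\theta_m)\in(S^1)^{m+1}$ that are distinct and in clockwise cyclic order, i.e. that have representatives in $\mathbb R$ with $\theta_0>\theta_1>\cdots>\theta_m>\theta_0-1$. It is integrated over with Lebesgue measure $d\theta_0\cdots d\theta_m$. Quantum HKR map $\sigma^\hbar:\mathcal A^{\otimes(m+1)}\to\Omega^m_{\mathcal A}[\hbar]$, extended $\mathbb C[\hbar]$-linearly to $\mathcal A^{\otimes (m+1)}[\hbar]$: $$\sigma^\hbar(f_0\otimes\cdots\otimes f_m)=\int_{\mathrm{Cyc}_{m+1}(S^1)}d\theta_0\cdots d\theta_m\ \exp\Big(i\hbar\sum_{k,l=0}^m\sum_{i=1}^r G(\theta_k,\theta_l)\frac{\partial}{\partial x^{i,(k)}}\frac{\partial}{\partial p_i^{(l)}}\Big)f_0(\mathbf x^{(0)},\mathbf p^{(0)})\,df_1(\mathbf x^{(1)},\mathbf p^{(1)})\wedge\cdots\wedge df_m(\mathbf x^{(m)},\mathbf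 p^{(m)})\Big|_{\mathbf x^{(k)}=\mathbf x,\ \mathbf p^{(k)}=\mathbf p\ \forall k}.$$ Here $df_k(\mathbf x^{(k)},\mathbf p^{(k)})=\sum_i\big((\partial_{x^i}f_k)(\mathbf x^{(k)},\mathbf p^{(k)})\,dx^i+(\partial_{p_i}f_k)(\mathbf x^{(k)},\mathbf p^{(k)})\,dp_i\big)$, and the differential operators act only on the coefficient functions, not on the symbols $dx^i,dp_i$. In $\Delta:\Omega^m_{\mathcal A}\to\Omega^{m-1}_{\mathcal A}$ (extended $\mathbb C[\hbar]$-linearly), $\iota_V$ denotes contraction of a form with the vector field $V$, and $\frac{\partial}{\partial x^i}$, $\frac{\partial}{\partial p_i}$ act on the coefficients of forms with respect to the basis of wedge products of the $dx^j,dp_j$. *)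

(* Defs.v *)
From HB Require Import structures.
From mathcomp Require Import all_boot all_order all_algebra.
From mathcomp Require Import complex.
(* Without its notations, multinomials' mpoly can be imported next to
   mathcomp-analysis; [mpoly n K] is the ring usually denoted {mpoly K[n]}. *)
From mathcomp Require Import -(notations) mpoly.
From mathcomp Require Import all_classical all_reals all_analysis.

Set Implicit Arguments.
Unset Strict Implicit.
Unset Printing Implicit Defensive.

Import Order.TTheory GRing.Theory Num.Theory.

Local Open Scope ring_scope.

(* Tensor powers of a polynomial ring K[y_0, ..., y_(n-1)].
   The (m+1)-fold tensor power over K is the polynomial ring in m+1 copies
   y^(0), ..., y^(m) of the variables, a_0 (x) ... (x) a_m being the product
   a_0(y^(0)) ... a_m(y^(m)). *)
Section Tensor.
Variables (K : comNzRingType) (n m : nat).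

Definition tensor := mpoly (m.+1 * n) K.

Definition slot_var (k : 'I_m.+1) (v : 'I_n) : 'I_(m.+1 * n) :=
  mxvec_index k v.

Definition in_slot (k : 'I_m.+1) (f : mpoly n K) : tensor :=
  comp_mpoly [tuple mpolyX K (mnm1 (slot_var k v)) | v < n] f.

Definition pure_tensor (a : 'I_m.+1 -> mpoly n K) : tensor :=
  \prod_(k < m.+1) in_slot k (a k).

(* The substitution y^(k) := y for all k. *)
Definition diagonal (F : tensor) : mpoly n K :=
  comp_mpoly
    [tuple mxvec (\matrix_(k < m.+1, v < n) mpolyX K (mnm1 v)) ord0 t
      | t < m.+1 * n] F.

Definition slot_mnm (mu : multinom (m.+1 * n)) (k : 'I_m.+1) : multinom n :=
  Multinom [tuple mu (slot_var k v) | v < n].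

(* The K-linear map on the tensor power which is given by phi on the basis of
   pure tensors of monomials. When phi is K-multilinear, it is the unique
   K-linear map with value phi a on every pure tensor pure_tensor a. *)
Definition linear_ext (V : lmodType K) (phi : ('I_m.+1 -> mpoly n K) -> V)
    (F : tensor) : V :=
  \sum_(mu <- msupp F)
    mcoeff mu F *: phi (fun k => mpolyX K (slot_mnm mu k)).

Lemma linear_ext_mnm (V : lmodType K) (phi : ('I_m.+1 -> mpoly n K) -> V)
    (mu : 'I_m.+1 -> multinom n) :
  linear_ext phi (pure_tensor (fun k => mpolyX K (mu k)))
  = phi (fun k => mpolyX K (mu k)).
Proof.
have -> : pure_tensor (fun k => mpolyX K (mu k))
    = mpolyX K (Multinom [tuple mxvec (\matrix_(k < m.+1, v < n) mu k v) ord0 t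
                           | t < m.+1 * n]).
  rewrite /pure_tensor /in_slot mpolyXE_id.
  rewrite (reindex _ (curry_mxvec_bij _ _)) /=.
  rewrite (eq_bigr (fun p : 'I_m.+1 * 'I_n =>
      mpolyX K (mnm1 (mxvec_index p.1 p.2)) ^+ mu p.1 p.2)); last first.
    by case=> k v _; rewrite /fun_of_multinom tnth_mktuple mxvecE mxE.
  rewrite -(pair_bigA _ (fun k v =>
      mpolyX K (mnm1 (mxvec_index k v)) ^+ mu k v)) /=.
  apply: eq_bigr => k _; rewrite comp_mpolyX; apply: eq_bigr => v _.
  by rewrite tnth_mktuple.
rewrite /linear_ext msuppX big_seq1 mcoeffX eqxx scale1r; congr phi.
apply: funext => k; congr mpolyX; apply/mnmP => v.
by rewrite /slot_mnm mnmE /slot_var /fun_of_multinom tnth_mktuple mxvecE mxE.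
Qed.

End Tensor.

(* Differential forms in dy_0, ..., dy_(n-1) with coefficients in B (all
   degrees together): [w S] is the coefficient of dy_s1 /\ ... /\ dy_sq, where
   s1 < ... < sq are the elements of S. The dy_v are symbols, so the ring B of
   coefficients need not be a ring of functions of y_0, ..., y_(n-1) only. *)
Section Forms.
Variables (B : comNzRingType) (n : nat).

Definition form := {ffun {set 'I_n} -> B}.

Definition form_one : form := [ffun S : {set 'I_n} => (S == finset.set0)%:R].

(* dy_S /\ dy_T = wedge_sign S T * dy_(S :|: T) for disjoint S and T. *)
Definition wedge_sign (S T : {set 'I_n}) : B :=
  (-1) ^+ #|[set p : 'I_n * 'I_n | [&& p.1 \in S, p.2 \in T & (p.2 < p.1)%N]]|.

Definition wedge (w1 w2 : form) : form :=
  [ffun S : {set 'I_n} => \sum_(T : {set 'I_n} | T \subset S)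
     wedge_sign T (S :\: T) * (w1 T * w2 (S :\: T))].

Definition one_form (c : 'I_n -> B) : form :=
  [ffun S : {set 'I_n} => \sum_(v < n | S == [set v]) c v].

Definition contraction (v : 'I_n) (w : form) : form :=
  [ffun S : {set 'I_n} =>
     if v \in S then 0
     else (-1) ^+ #|[set s in S | (s < v)%N]| * w (v |: S)].

End Forms.

(* Lebesgue measure on the torus (S^1)^q, the circle R/Z being identified with
   the fundamental domain [0, 1[. *)
Local Open Scope classical_set_scope.

Section Torus.
Variable R : realType.
Local Notation mR := (measurableTypeR R).

Lemma measurable_domain : measurable (`[0%R, 1%R[ : set mR).
Proof. exact: measurable_itv. Qed.

Definition circle_measure := mrestr (@lebesgue_measure R) measurable_domain.

HB.instance Definition _ := Measure.on circle_measure.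

Lemma circle_measureT : circle_measure setT = 1%E.
Proof.
rewrite /circle_measure /mrestr setTI.
by rewrite (lebesgue_measure_itv (Interval _ _)) /= lte_fin ltr01 oppr0 adde0.
Qed.

HB.instance Definition _ :=
  Measure_isProbability.Build _ _ _ circle_measure circle_measureT.

Definition tcons q (p : mR * q.-tuple mR) : q.+1.-tuple mR :=
  [tuple of p.1 :: p.2].

Lemma measurable_tcons q : measurable_fun setT (@tcons q).
Proof. exact: measurable_cons measurable_fst measurable_snd. Qed.

HB.instance Definition _ q :=
  isMeasurableFun.Build _ _ _ _ (@tcons q) (@measurable_tcons q).

Fixpoint torus_measure q : probability (q.-tuple mR) R :=
  match q return probability (q.-tuple mR) R with
  | 0 => dirac [tuple]
  | q'.+1 => distribution (circle_measure \x torus_measure q')%E (@tcons q')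
  end.

(* Points of S^1 are given by arbitrary real representatives. *)
Definition green (t s : R) : R :=
  let d := (s - t) - (Num.floor (s - t))%:~R in
  if d == 0 then 0 else d - 2^-1.

Definition cyc m : set (m.+1.-tuple mR) :=
  [set th | exists z : 'I_m.+1 -> int,
     let t := fun k => tnth th k + (z k)%:~R in
     (forall k l : 'I_m.+1, (k < l)%N -> t l < t k) /\ t ord0 - 1 < t ord_max].

End Torus.

Section Integral.
Context d (T : measurableType d) (R : realType).
Variables (mu : {measure set T -> \bar R}) (D : set T).

Definition cintegral (f : T -> R[i]) : R[i] :=
  ((\int[mu]_(x in D) complex.Re (f x))
   +i* (\int[mu]_(x in D) complex.Im (f x)))%C.

(* The coefficientwise integral of a function with values in C[hbar][y]. It
   exists as soon as the degrees of the values are bounded (mpoly_integralP),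
   and it is unique (mpoly_integral_uniq); the default value 0 plays no role. *)
Definition is_mpoly_integral n (Phi : T -> mpoly n {poly R[i]})
    (I : mpoly n {poly R[i]}) :=
  forall (a : multinom n) (j : nat),
    (mcoeff a I)`_j = cintegral (fun x => (mcoeff a (Phi x))`_j).

Definition mpoly_integral n (Phi : T -> mpoly n {poly R[i]}) :
    mpoly n {poly R[i]} :=
  xget 0 [set I | is_mpoly_integral Phi I].

Lemma cintegral0 : cintegral (fun=> 0) = 0.
Proof. by rewrite /cintegral /= /Rintegral integral0. Qed.

Lemma mpoly_integralP n (Phi : T -> mpoly n {poly R[i]}) (N : nat) :
  (forall x, mmeasure mdeg (Phi x) <= N)%N ->
  (forall x a, size (mcoeff a (Phi x)) <= N)%N ->
  is_mpoly_integral Phi (mpoly_integral Phi).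
Proof.
move=> degN sizeN; rewrite /mpoly_integral.
case: xgetP => [I _ //| noI]; exfalso.
pose c (a : multinom n) j := cintegral (fun x => (mcoeff a (Phi x))`_j).
apply: (noI (\sum_(a : bmultinom n N) (\poly_(j < N) c a j) *: mpolyX _ a)).
move=> a j; rewrite raddf_sum /=.
have [aN|aN] := ltnP (mdeg a) N.
  rewrite (bigD1 (BMultinom aN)) //= big1 ?addr0; last first.
    move=> b; rewrite -val_eqE /= => /negPf ba.
    by rewrite mcoeffZ mcoeffX ba mulr0.
  rewrite mcoeffZ mcoeffX eqxx mulr1 coef_poly; case: ltnP => // jN.
  rewrite -[LHS]cintegral0; congr cintegral; apply: funext => x.
  by rewrite nth_default // (leq_trans (sizeN x a)).
rewrite big1 ?coef0; last first.
  move=> b _; rewrite mcoeffZ mcoeffX; case: eqP => [ba|]; last by rewrite mulr0.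
  by move: (bmdeg b); rewrite ba ltnNge aN.
rewrite -[LHS]cintegral0; congr cintegral; apply: funext => x.
rewrite memN_msupp_eq0 ?coef0 //; apply/negP => /msize_mdeg_lt ax.
by move: (leq_trans ax (degN x)); rewrite ltnNge aN.
Qed.

Lemma mpoly_integral_uniq n (Phi : T -> mpoly n {poly R[i]}) I J :
  is_mpoly_integral Phi I -> is_mpoly_integral Phi J -> I = J.
Proof.
by move=> hI hJ; apply/mpolyP => a; apply/polyP => j; rewrite hI hJ.
Qed.

Definition form_integral n q (Phi : T -> form (mpoly n {poly R[i]}) q) :
    form (mpoly n {poly R[i]}) q :=
  [ffun S => mpoly_integral (fun x => Phi x S)].

End Integral.

Section QuantumHKR.
Variables (R : realType) (r : nat).
Local Notation C := R[i].

(* C[hbar], the variable being hbar; everything below is C[hbar]-linear. *)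
Definition Ch := {poly C}.
Definition hbar : Ch := 'X.
Definition ihbar : Ch := 'i%C *: hbar.

(* The variables are x^1, ..., x^r, p_1, ..., p_r, in this order. *)
Definition xvar (i : 'I_r) : 'I_(r + r) := lshift r i.
Definition pvar (i : 'I_r) : 'I_(r + r) := rshift r i.

Definition polA := mpoly (r + r) C.
Definition polAh := mpoly (r + r) Ch.
Definition polA_inj (f : polA) : polAh := map_mpoly polyC f.

(* m-chains of the Weyl algebra and forms with coefficients in A[hbar]. *)
Definition chain m := tensor Ch (r + r) m.
Definition formAh := form polAh (r + r).

(* exp(L) for an operator L that lowers the total degree: L^j F = 0 as soon as
   j > deg F, and mmeasure mdeg F is deg F + 1. *)
Definition exp_op N (L : mpoly N Ch -> mpoly N Ch) (F : mpoly N Ch) :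
    mpoly N Ch :=
  \sum_(j < mmeasure mdeg F) ((j`!%:R : C)^-1)%:P *: iter j L F.

Definition dx m (k : 'I_m.+1) (i : 'I_r) (F : chain m) : chain m :=
  mderiv (slot_var k (xvar i)) F.
Definition dp m (k : 'I_m.+1) (i : 'I_r) (F : chain m) : chain m :=
  mderiv (slot_var k (pvar i)) F.

(* The tensor slots 0 and 1 carry the left and the right factor. *)
Definition moyal_op (F : chain 1) : chain 1 :=
  ((2^-1 : C) *: ihbar) *:
    \sum_(j < r) (dx ord0 j (dp ord_max j F) - dp ord0 j (dx ord_max j F)).

Definition moyal (f g : polAh) : polAh :=
  diagonal (exp_op moyal_op
    (pure_tensor (fun k : 'I_2 => if k == ord0 then f else g))).

(* a_0, ..., a_k * a_(k+1), ..., a_(m+1) *)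
Definition merge_at m (a : 'I_m.+2 -> polAh) (k : 'I_m.+1) : 'I_m.+1 -> polAh :=
  fun l => if (l < k)%N then a (widen_ord (leqnSn _) l)
           else if l == k then
             moyal (a (widen_ord (leqnSn _) l)) (a (lift ord0 l))
           else a (lift ord0 l).

(* a_(m+1) * a_0, a_1, ..., a_m *)
Definition merge_last m (a : 'I_m.+2 -> polAh) : 'I_m.+1 -> polAh :=
  fun l => if l == ord0 then moyal (a ord_max) (a ord0)
           else a (widen_ord (leqnSn _) l).

Definition hochschild_pure m (a : 'I_m.+2 -> polAh) : chain m :=
  \sum_(k < m.+1) (-1) ^+ k *: pure_tensor (merge_at a k)
  + (-1) ^+ m.+1 *: pure_tensor (merge_last a).

(* On 0-chains, b = 0; the target chain 0.-1 is then immaterial. *)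
Definition hochschild m : chain m -> chain m.-1 :=
  match m return chain m -> chain m.-1 with
  | 0 => fun=> 0
  | m'.+1 => linear_ext (@hochschild_pure m')
  end.

(* f_0(y^(0)) d f_1(y^(1)) /\ ... /\ d f_m(y^(m)) *)
Definition d_slot m (k : 'I_m.+1) (f : polAh) : form (chain m) (r + r) :=
  one_form (fun v => in_slot k (mderiv v f)).

Definition pre_form m (f : 'I_m.+1 -> polAh) : form (chain m) (r + r) :=
  let w := \big[@wedge (chain m) (r + r)/form_one (chain m) (r + r)]_(k < m)
             d_slot (lift ord0 k) (f (lift ord0 k)) in
  [ffun S => in_slot ord0 (f ord0) * w S].

Definition green_op m (th : m.+1.-tuple (measurableTypeR R)) (F : chain m) :
    chain m :=
  ihbar *: \sum_(k < m.+1) \sum_(l < m.+1) \sum_(i < r)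
    ((green (tnth th k) (tnth th l))%:C%C)%:P *: dx k i (dp l i F).

Definition sigma_integrand m (f : 'I_m.+1 -> polAh)
    (th : m.+1.-tuple (measurableTypeR R)) : formAh :=
  [ffun S => diagonal (exp_op (green_op th) (pre_form f S))].

Definition sigma_pure m (f : 'I_m.+1 -> polAh) : formAh :=
  form_integral (torus_measure R m.+1) (@cyc R m) (sigma_integrand f).

Definition sigma m : chain m -> formAh := linear_ext (@sigma_pure m).

Definition coef_deriv (v : 'I_(r + r)) (w : formAh) : formAh :=
  [ffun S => mderiv v (w S)].

Definition Delta (w : formAh) : formAh :=
  \sum_(i < r) (coef_deriv (xvar i) (contraction (pvar i) w)
                - coef_deriv (pvar i) (contraction (xvar i) w)).

End QuantumHKR.

(* Main.v *)
Require Import Defs.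
From HB Require Import structures.
From mathcomp Require Import all_boot all_order all_algebra.
From mathcomp Require Import complex ring lra zify.
From mathcomp Require Import -(notations) mpoly.
From mathcomp Require Import all_classical all_reals all_analysis.
From mathcomp Require Import measurable_realfun.
(* Once more, so that [diagonal] is the substitution on chains and not the
   diagonal relation of a set. *)
Import Defs.
Import Order.TTheory GRing.Theory Num.Theory.
Import numFieldNormedType.Exports.
Local Open Scope ring_scope.

Set Implicit Arguments.
Unset Strict Implicit.
Unset Printing Implicit Defensive.

(** Chains are polynomials in m + 1 copies of the variables, the slots. Both
    sides of the theorem are C[hbar]-linear in the chain, and the proof is an
    identity between linear operators on all chains (sigma_hochschildS); pure
    tensors serve only to identify these operators (sigmaE, hochschildE).

    The exponent of sigma is a second-order operator with constant coefficients
      D_g = i hbar sum_(k, l, i) g k l d/dx^i,(k) d/dp_i^(l),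
    where g is Green's function at the points of a configuration. Such operators
    commute and lower the degree, hence exp (D_g + D_g') = exp D_g exp D_g'
    (exp_opD). The Moyal product of the slots p and q is the exponential of D_g
    for the antisymmetric kernel g with values 1/2 at (p, q) and -1/2 at (q, p),
    followed by the identification of the two slots (pure_tensor_merge). Since
    these values are the one-sided limits of Green's function at 0, the limit of
    the integrand when two neighbouring points collide is the integrand of the
    chain in which their slots have been multiplied (diagonal_exp_merge).

    A configuration in Cyc is given by theta_0 and the gaps
    u_i = theta_i - theta_0 in R/Z, which fill the simplex
    1 > u_1 > ... > u_m > 0 (cycP). On it Green's function is affine in the gaps
    (green_cyc), so the integrand is polynomial in them and every integral is a
    combination of the moments of the simplex (torus_moment_cyc), for which the
    Stokes formula is an identity between rational numbers (simplex_stokes). In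
    the direction u_l, the derivative of the exponent is
      A_l = i hbar sum_(k, i) (d/dx^i,(k) d/dp_i^(l) - d/dp_i^(k) d/dx^i,(l)),
    and the Stokes formula says that the integral of A_l F is the integral of F
    with the slots l - 1 and l multiplied, minus that of F with the slots l and
    l + 1 multiplied, where the slot 0 comes after the last one
    (slots_int_stokes).

    It remains to collect terms. In sigma (b F) every slot from 1 on carries one
    derivative. By the Leibniz rule, the derivative at a product of two slots
    falls on either factor, so that before the multiplication there is one slot
    l > 0 without derivative. For each l there are two such terms, with opposite
    signs: the slot l multiplied with its left or with its right neighbour.
    These are the boundary terms for A_l (sigma_coef_hochschild). On the other
    side, the sum over all slots k in A_l is a total derivative after the
    integration (gap_op_slots_int), while the derivative in the slot l is
    produced by the contraction of d f_1 /\ ... /\ d f_m, an antiderivation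
    (contraction_sigma): the sum over l of the integrals of A_l F is thus
    i hbar Delta. For m = 0 both sides vanish. *)

(** * Substituting variables for variables *)
Section Rename.
Variable K : comNzRingType.

(** The restriction to the diagonal, the inclusion of a tensor factor and the
    identification of two tensor factors are all of this form. *)
Definition rename N N' (phi : 'I_N -> 'I_N') (F : mpoly N K) : mpoly N' K :=
  comp_mpoly [tuple mpolyX K (mnm1 (phi t)) | t < N] F.

Section Morphism.
Variables (N N' : nat) (phi : 'I_N -> 'I_N').

Lemma rename_linear : linear (rename phi).
Proof. by move=> c F G; rewrite /rename linearP. Qed.

HB.instance Definition _ :=
  GRing.isLinear.Build K (mpoly N K) (mpoly N' K) _ (rename phi) rename_linear.

Lemma renameM : {morph rename phi : F G / F * G}.
Proof. by move=> F G; rewrite /rename rmorphM. Qed.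

Lemma rename1 : rename phi 1 = 1.
Proof. by rewrite /rename rmorph1. Qed.

Lemma rename_prod I (s : seq I) (P : pred I) (F : I -> mpoly N K) :
  rename phi (\prod_(i <- s | P i) F i) = \prod_(i <- s | P i) rename phi (F i).
Proof. exact: (big_morph _ renameM rename1). Qed.

Lemma renameX t : rename phi (mpolyX K (mnm1 t)) = mpolyX K (mnm1 (phi t)).
Proof. by rewrite /rename comp_mpolyXU -tnth_nth tnth_mktuple. Qed.

End Morphism.

Lemma renameX_prod N N' (phi : 'I_N -> 'I_N') (mu : multinom N) :
  rename phi (mpolyX K mu) = \prod_(t < N) mpolyX K (mnm1 (phi t)) ^+ mu t.
Proof.
by rewrite /rename comp_mpolyX; apply: eq_bigr => t _; rewrite tnth_mktuple.
Qed.

Lemma mpoly_linear_eq N (V : lmodType K) (L1 L2 : {linear mpoly N K -> V}) :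
  (forall mu, L1 (mpolyX K mu) = L2 (mpolyX K mu)) -> L1 =1 L2.
Proof.
move=> eqL F; rewrite [F]mpolyE !linear_sum; apply: eq_bigr => mu _.
by rewrite !linearZ /= eqL.
Qed.

Lemma rename_comp N N' N'' (phi : 'I_N -> 'I_N') (psi : 'I_N' -> 'I_N'') F :
  rename psi (rename phi F) = rename (psi \o phi) F.
Proof.
apply: (@mpoly_linear_eq _ _ (rename psi \o rename phi) (rename (psi \o phi))).
move=> mu /=; rewrite !renameX_prod.
have rX : forall e t,
    rename psi (mpolyX K (mnm1 t) ^+ e) = mpolyX K (mnm1 (psi t)) ^+ e.
  by elim=> [|e IH] t; rewrite ?expr0 ?rename1 // !exprS renameM IH renameX.
rewrite (big_morph _ (renameM psi) (rename1 psi)).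
by apply: eq_bigr => t _; rewrite rX.
Qed.

Lemma mderivXU N (v t : 'I_N) : mderiv v (mpolyX K (mnm1 t)) = (t == v)%:R.
Proof.
rewrite mderivX mnm1E; case: eqP => [->|_]; last by rewrite scale0r.
rewrite scale1r -[RHS]mpolyX0; congr mpolyX; apply/mnmP => i.
by rewrite mnmBE mnm0E subnn.
Qed.

(** The chain rule. Both sides obey the Leibniz rule, so it is enough to check
    them on variables. *)
Lemma mderiv_rename N N' (phi : 'I_N -> 'I_N') v F :
  mderiv v (rename phi F) = \sum_(t | phi t == v) rename phi (mderiv t F).
Proof.
pose good G := mderiv v (rename phi G)
               = \sum_(t | phi t == v) rename phi (mderiv t G).
have good1 : good 1.
  rewrite /good rename1 -mpolyC1 mderivC big1 // => t _.
  by rewrite mderivC linear0.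
have goodM G H : good G -> good H -> good (G * H).
  rewrite /good renameM mderivM => -> ->.
  rewrite mulr_suml mulr_sumr -big_split; apply: eq_bigr => t _ /=.
  by rewrite mderivM linearD /= !renameM.
have goodX t : good (mpolyX K (mnm1 t)).
  rewrite /good renameX mderivXU.
  under eq_bigr => u _ do rewrite mderivXU.
  have [tv|tv] := eqVneq (phi t) v.
    rewrite (bigD1 t) ?tv //= eqxx rename1 big1 ?addr0 // => u /andP[_ ut].
    by rewrite eq_sym (negbTE ut) linear0.
  rewrite big1 // => u; case: (eqVneq t u) => [<-|_ _]; last by rewrite linear0.
  by rewrite (negbTE tv).
have goodXn t e : good (mpolyX K (mnm1 t) ^+ e).
  by elim: e => [|e IH]; rewrite ?expr0 // exprS; apply: goodM.
have goodmon mu : good (mpolyX K mu).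
  by rewrite mpolyXE_id; apply: (big_ind good) => // t _; apply: goodXn.
elim/mpolyind: F => [|c mu F _ _ IH].
  by rewrite !raddf0 big1 // => t _; rewrite !raddf0.
rewrite (linearP (rename phi)) linearP /= IH (goodmon mu) scaler_sumr -big_split.
by apply: eq_bigr => t _ /=; rewrite linearP linearP.
Qed.

Lemma mderiv_rename_inj N N' (phi : 'I_N -> 'I_N') t F :
  (forall u, phi u = phi t -> u = t) ->
  mderiv (phi t) (rename phi F) = rename phi (mderiv t F).
Proof.
move=> phit; rewrite mderiv_rename (bigD1 t) //= big1 ?addr0 //.
by move=> u /andP[/eqP /phit -> /eqP].
Qed.

Lemma mmeasure_mderiv N (v : 'I_N) (F : mpoly N K) d :
  (mmeasure mdeg F <= d.+1 -> mmeasure mdeg (mderiv v F) <= d)%N.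
Proof.
move=> Fd; rewrite mmeasureE; apply/bigmax_leqP_seq => mu mu_supp _.
move: mu_supp; rewrite mcoeff_msupp mcoeff_mderiv; apply: contra_neqT.
rewrite -leqNgt => dmu; rewrite memN_msupp_eq0 ?mul0rn //.
by apply: msize_mdeg_ge; rewrite mdegD mdeg1 addn1 (leq_trans Fd).
Qed.

End Rename.

(** * Exponentials of operators that lower the degree *)
Section Exponential.
Variable R : realType.
Local Notation C := R[i].

Definition inv_fact j : Ch R := ((j`!%:R : C)^-1)%:P.

Lemma inv_fact0 : inv_fact 0 = 1.
Proof. by rewrite /inv_fact fact0 invr1. Qed.

Lemma inv_factS j : j.+1%:R * inv_fact j.+1 = inv_fact j.
Proof.
rewrite /inv_fact -polyC_natr -polyCM factS natrM invfM mulrA mulfV ?mul1r // pnatr_eq0.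
Qed.

Section Operators.
Variable N : nat.
Implicit Types (F : mpoly N (Ch R)) (L : {linear mpoly N (Ch R) -> mpoly N (Ch R)}).

(** [mmeasure mdeg F] is one more than the degree of F, and 0 for F = 0; in
    particular such an operator annihilates the constants. *)
Definition lowers (L : mpoly N (Ch R) -> mpoly N (Ch R)) :=
  forall d F, (mmeasure mdeg F <= d.+1 -> mmeasure mdeg (L F) <= d)%N.

Lemma iter_lowers (L : mpoly N (Ch R) -> mpoly N (Ch R)) j d F :
  lowers L ->
  (mmeasure mdeg F <= d + j -> mmeasure mdeg (iter j L F) <= d)%N.
Proof.
move=> lowL; elim: j d => [|j IH] d; first by rewrite addn0.
by rewrite addnS -addSn => /IH /lowL.
Qed.

Lemma iter_lowers_eq0 (L : mpoly N (Ch R) -> mpoly N (Ch R)) j F :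
  lowers L -> (mmeasure mdeg F <= j)%N -> iter j L F = 0.
Proof.
move=> lowL Fj; apply/eqP; rewrite -msize_poly_eq0 -leqn0.
exact: iter_lowers lowL _.
Qed.

(** The length of the sum [exp_op L F] depends on F. Comparing the values at
    several chains requires a common length. *)
Definition exp_trunc M (L : mpoly N (Ch R) -> mpoly N (Ch R)) F :=
  \sum_(j < M) inv_fact j *: iter j L F.

Lemma exp_opE M (L : mpoly N (Ch R) -> mpoly N (Ch R)) F :
  lowers L -> (mmeasure mdeg F <= M)%N -> exp_op L F = exp_trunc M L F.
Proof.
move=> lowL FM; rewrite /exp_op /exp_trunc.
rewrite -(big_mkord xpredT (fun j => inv_fact j *: iter j L F)).
rewrite -(big_mkord xpredT (fun j => inv_fact j *: iter j L F)).
rewrite (big_cat_nat (leq0n _) FM) //= [X in _ + X]big_nat_cond [X in _ + X]big1 ?addr0 //.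
by move=> j /andP[/andP[Fj _] _]; rewrite iter_lowers_eq0 ?scaler0.
Qed.

Lemma iter_linear L j : linear (iter j L).
Proof. by elim: j => [|j IH] c F G //=; rewrite IH linearP. Qed.

Lemma exp_op_linear L : lowers L -> linear (exp_op L).
Proof.
move=> lowL c F G.
pose M := maxn (mmeasure mdeg (c *: F + G)) (maxn (mmeasure mdeg F) (mmeasure mdeg G)).
rewrite !(@exp_opE M) ?leq_max ?leqnn ?orbT // /exp_trunc scaler_sumr -big_split.
apply: eq_bigr => j _ /=.
by rewrite iter_linear scalerDr !scalerA mulrC.
Qed.

Lemma mmeasure_exp_op L F d :
  lowers L -> (mmeasure mdeg F <= d -> mmeasure mdeg (exp_op L F) <= d)%N.
Proof.
move=> lowL Fd; rewrite /exp_op; apply: leq_trans (mmeasure_sum _ _ _ _) _.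
apply/bigmax_leqP => j _; apply: leq_trans (mmeasureZ_le _ _ _) _.
by apply: iter_lowers => //; rewrite (leq_trans Fd) ?leq_addr.
Qed.

Section Sum.
Variables L1 L2 : {linear mpoly N (Ch R) -> mpoly N (Ch R)}.
Hypothesis L12 : forall F, L1 (L2 F) = L2 (L1 F).
Hypotheses (low1 : lowers L1) (low2 : lowers L2).
Let L3 F := L1 F + L2 F.

Lemma lowersD : lowers L3.
Proof.
move=> d F Fd; apply: leq_trans (mmeasureD_le _ _ _) _.
by rewrite geq_max low1 ?low2.
Qed.

Let term F i j := inv_fact i *: iter i L1 (inv_fact j *: iter j L2 F).

Let term1 F i j : L1 (term F i j) = i.+1%:R *: term F i.+1 j.
Proof. by rewrite /term linearZ scalerA inv_factS. Qed.

Let term2 F i j : L2 (term F i j) = j.+1%:R *: term F i j.+1.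
Proof.
have comm k G : L2 (iter k L1 G) = iter k L1 (L2 G).
  by elim: k => //= k IH; rewrite -L12 IH.
rewrite /term linearZ /= comm linearZ /= -[L2 (iter _ _ _)]/(iter j.+1 L2 F).
have itZ c G : iter i L1 (c *: G) = c *: iter i L1 G.
  by elim: (i) => //= k ->; rewrite linearZ.
by rewrite !itZ !scalerA -(inv_factS j); congr (_ *: _); ring.
Qed.

(** The binomial theorem for the divided powers of commuting operators. By
    induction on j: L1 and L2 raise the two indices of [term i j], with factors
    i + 1 and j + 1 that add up to the order of the power. *)
Lemma divided_power_sum F j :
  inv_fact j *: iter j L3 F = \sum_(i < j.+1) term F i (j - i).
Proof.
elim: j => [|j IH].
  by rewrite big_ord_recl big_ord0 /term /= inv_fact0 !scale1r addr0.
have unit_j : (j.+1%:R : Ch R) * ((j.+1%:R : C)^-1)%:P = 1.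
  by rewrite -polyC_natr -polyCM mulfV ?polyC1 // pnatr_eq0.
suff eq_j : j.+1%:R *: (inv_fact j.+1 *: iter j.+1 L3 F)
          = j.+1%:R *: (\sum_(i < j.+2) term F i (j.+1 - i)).
  have := congr1 (fun G => ((j.+1%:R : C)^-1)%:P *: G) eq_j.
  by rewrite ![_ *: (j.+1%:R *: _)]scalerA (mulrC _ j.+1%:R) unit_j !scale1r.
rewrite scalerA inv_factS /= {1}/L3 scalerDr -!linearZ /= IH !linear_sum /=.
under eq_bigr => i _ do rewrite term1.
under [X in _ + X]eq_bigr => i _ do rewrite term2 -subSn -1?ltnS //.
have -> : \sum_(i < j.+2) (j.+1%:R : Ch R) *: term F i (j.+1 - i)
    = \sum_(i < j.+2) (i%:R : Ch R) *: term F i (j.+1 - i)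
      + \sum_(i < j.+2) ((j.+1 - i)%:R : Ch R) *: term F i (j.+1 - i).
  rewrite -big_split; apply: eq_bigr => i _ /=.
  by rewrite -scalerDl -natrD subnKC // -ltnS.
congr (_ + _); first by rewrite [RHS]big_ord_recl scale0r add0r.
by rewrite [RHS]big_ord_recr /= subnn scale0r addr0.
Qed.

(** The Cauchy product of two exponential series, which terminate because the
    operators lower the degree. *)
Lemma exp_opD F : exp_op L3 F = exp_op L1 (exp_op L2 F).
Proof.
pose M := mmeasure mdeg F.
rewrite (exp_opE lowersD (leqnn M)) (exp_opE low1 (mmeasure_exp_op low2 (leqnn M))).
rewrite (exp_opE low2 (leqnn M)) /exp_trunc.
under eq_bigr => j _.
  rewrite divided_power_sum.
  rewrite (big_ord_widen M (fun i => term F i (j - i))) //.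
  over.
rewrite (exchange_big_dep xpredT) //=; apply: eq_bigr => i _.
have -> : iter i L1 (\sum_(j < M) inv_fact j *: iter j L2 F)
          = \sum_(j < M) iter i L1 (inv_fact j *: iter j L2 F).
  by elim: (i : nat) => //= k ->; rewrite linear_sum.
rewrite scaler_sumr.
rewrite -(big_mkord (fun j => i < j.+1)%N (fun j => term F i (j - i))).
rewrite -(big_mkord xpredT (fun j => term F i j)).
have iM := ltnW (ltn_ord i).
rewrite (big_cat_nat (leq0n _) iM) //= big_nat_cond big1 ?add0r; last first.
  by move=> j /andP[/andP[_ ji]]; rewrite ltnS leqNgt ji.
rewrite [RHS](big_cat_nat (leq0n _) (leq_subr i M)) //= [X in _ + X]big_nat_cond.
rewrite [X in _ + X]big1 ?addr0; last first.
  move=> j /andP[/andP[ij _] _]; rewrite /term [iter i _ _]iter_lowers_eq0 ?scaler0 //.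
  apply: leq_trans (mmeasureZ_le _ _ _) _; apply: iter_lowers => //.
  by rewrite -leq_subLR.
rewrite -{1}[i : nat]add0n big_addn big_nat_cond [RHS]big_nat_cond.
by apply: eq_big => j; rewrite ?andbT ?ltnS ?leq_addl ?andbT // addnK.
Qed.

End Sum.
End Operators.

(** Exponentials pass through a change of slots as soon as the exponents do. *)
Lemma exp_op_intertwine N N' (T : mpoly N (Ch R) -> mpoly N' (Ch R)) L L' F :
  linear T -> lowers L -> lowers L' -> (forall G, T (L G) = L' (T G)) ->
  T (exp_op L F) = exp_op L' (T F).
Proof.
move=> linT lowL lowL' TL.
have T0 : T 0 = 0 by have := linT (-1) 0 0; rewrite scaler0 addr0 scaleN1r addNr.
pose M := maxn (mmeasure mdeg F) (mmeasure mdeg (T F)).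
rewrite !(@exp_opE _ M) ?leq_max ?leqnn ?orbT // /exp_trunc.
have TS n (G : 'I_n -> mpoly N (Ch R)) : T (\sum_j G j) = \sum_j T (G j).
  elim: n G => [|n IH] G; first by rewrite !big_ord0.
  by rewrite !big_ord_recl -{1}[G ord0]scale1r linT IH scale1r.
rewrite TS; apply: eq_bigr => j _.
rewrite -[X in T X]addr0 linT T0 addr0; congr (_ *: _).
by elim: (j : nat) => //= k IH; rewrite TL IH.
Qed.

End Exponential.

(** * Slots of a chain *)
Section Slots.
Variables (K : comNzRingType) (n : nat).

Lemma slot_var_inj m (k l : 'I_m.+1) (v w : 'I_n) :
  slot_var k v = slot_var l w -> (k, v) = (l, w).
Proof.
move=> kv_lw; case: (curry_mxvec_bij m.+1 n) => g gK _.
by rewrite -[LHS]gK // -[RHS]gK //=; congr g.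
Qed.

(** The map s need not be injective: the slots with the same image are
    multiplied together. *)
Definition slot_map m m' (s : 'I_m.+1 -> 'I_m'.+1) (t : 'I_(m.+1 * n)) :
    'I_(m'.+1 * n) :=
  mxvec (\matrix_(k < m.+1, v < n) slot_var (s k) v) ord0 t.

Definition diag_map m (t : 'I_(m.+1 * n)) : 'I_n :=
  mxvec (\matrix_(k < m.+1, v < n) v) ord0 t.

Lemma slot_map_var m m' (s : 'I_m.+1 -> 'I_m'.+1) k v :
  slot_map s (slot_var k v) = slot_var (s k) v.
Proof. by rewrite /slot_map mxvecE mxE. Qed.

Lemma diag_map_var m (k : 'I_m.+1) v : diag_map (slot_var k v) = v.
Proof. by rewrite /diag_map mxvecE mxE. Qed.

Lemma diagonalE m (F : tensor K n m) : diagonal F = rename (@diag_map m) F.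
Proof.
rewrite /diagonal /rename; congr comp_mpoly; apply: eq_from_tnth => t.
by rewrite !tnth_mktuple; case/mxvec_indexP: t => k v; rewrite diag_map_var mxvecE mxE.
Qed.

Lemma in_slotE m (k : 'I_m.+1) (f : mpoly n K) : in_slot k f = rename (slot_var k) f.
Proof. by []. Qed.

Lemma rename_in_slot m m' (s : 'I_m.+1 -> 'I_m'.+1) k (f : mpoly n K) :
  rename (slot_map s) (in_slot k f) = in_slot (s k) f.
Proof.
rewrite !in_slotE rename_comp; congr rename; apply: funext => v.
exact: slot_map_var.
Qed.

Lemma big_slot m (V : nmodType) (P : pred 'I_(m.+1 * n)) (G : 'I_(m.+1 * n) -> V) :
  \sum_(t | P t) G t = \sum_k \sum_(v | P (slot_var k v)) G (slot_var k v).
Proof.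
rewrite big_mkcond (reindex _ (curry_mxvec_bij _ _)) /=.
under [RHS]eq_bigr => k _ do rewrite big_mkcond.
by rewrite pair_bigA; apply: eq_bigr => -[k v] _.
Qed.

(** The Leibniz rule, the slots with image j being the factors of a product. *)
Lemma mderiv_slot_map m m' (s : 'I_m.+1 -> 'I_m'.+1) j v (F : tensor K n m) :
  mderiv (slot_var j v) (rename (slot_map s) F)
  = \sum_(k | s k == j) rename (slot_map s) (mderiv (slot_var k v) F).
Proof.
rewrite mderiv_rename big_slot [RHS]big_mkcond; apply: eq_bigr => k _ /=.
case: eqP => [skj|skj].
  rewrite (bigD1 v) /=; last by rewrite slot_map_var skj.
  rewrite big1 ?addr0 // => w; rewrite slot_map_var skj => /andP[/eqP jw].
  by case: (slot_var_inj jw) => ->; rewrite eqxx.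
rewrite big1 // => w; rewrite slot_map_var => /eqP jw.
by case: (slot_var_inj jw) => /skj.
Qed.

(** The Leibniz rule: on the diagonal, the sum over all slots of a derivative is
    a total derivative. The derivatives in Delta arise in this way. *)
Lemma mderiv_diagonal m v (F : tensor K n m) :
  mderiv v (diagonal F) = \sum_k diagonal (mderiv (slot_var k v) F).
Proof.
rewrite diagonalE mderiv_rename big_slot; apply: eq_bigr => k _ /=.
under eq_bigl => w do rewrite diag_map_var.
by rewrite big_pred1_eq diagonalE.
Qed.

Lemma diagonal_slot_map m m' (s : 'I_m.+1 -> 'I_m'.+1) (F : tensor K n m) :
  diagonal (rename (slot_map s) F) = diagonal F.
Proof.
rewrite !diagonalE rename_comp; congr rename; apply: funext => t.
case/mxvec_indexP: t => k v /=.
by rewrite -!/(slot_var _ _) slot_map_var !diag_map_var.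
Qed.

(** With e the inclusion of the two slots of a Moyal product, this reduces the
    multiplication of two slots of a long chain to a chain with two slots. *)
Lemma rename_slot_map_const m m' m'' (e : 'I_m.+1 -> 'I_m'.+1)
    (s : 'I_m'.+1 -> 'I_m''.+1) y (F : tensor K n m) :
  (forall k, s (e k) = y) ->
  rename (slot_map s) (rename (slot_map e) F) = in_slot y (diagonal F).
Proof.
move=> sy; rewrite in_slotE diagonalE !rename_comp; congr rename.
apply: funext => t; case/mxvec_indexP: t => k v /=.
by rewrite -!/(slot_var _ _) !slot_map_var diag_map_var sy.
Qed.

Lemma pure_tensorD2 m (z p q : 'I_m.+2) (y : 'I_m.+1) (a : 'I_m.+2 -> mpoly n K) :
  (p = lift z y /\ q = z) \/ (p = z /\ q = lift z y) ->
  pure_tensor a = in_slot p (a p) * in_slot q (a q)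
                  * \prod_(j < m.+1 | j != y) in_slot (lift z j) (a (lift z j)).
Proof.
rewrite /pure_tensor (bigD1_ord z) //= (bigD1 y) //= mulrA.
case=> [[-> ->]|[-> ->]]; last exact: erefl.
exact: (congr1 (fun G => G * _) (mulrC (in_slot z _) _)).
Qed.

Lemma pure_tensor2 (a : 'I_2 -> mpoly n K) :
  pure_tensor a = in_slot ord0 (a ord0) * in_slot ord_max (a ord_max).
Proof.
rewrite /pure_tensor (bigD1_ord ord0) //=; congr (_ * _).
rewrite (bigD1_ord ord0) //= big_ord0 mulr1.
by have -> : lift ord0 ord0 = ord_max :> 'I_2 by apply: val_inj.
Qed.

End Slots.

(** * Bidifferential operators and the Moyal product *)
Section Bidifferential.
Variables (R : realType) (r : nat).
Local Notation C := R[i].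

(** The exponents of sigma and of the Moyal product have this form, with g
    Green's function at a configuration and the antisymmetric kernel below,
    respectively. *)
Definition bidiff m (g : 'I_m.+1 -> 'I_m.+1 -> C) (F : chain R r m) : chain R r m :=
  ihbar R *: \sum_(k < m.+1) \sum_(l < m.+1) \sum_(i < r)
    (g k l)%:P *: dx k i (dp l i F).

Lemma bidiff_linear m (g : 'I_m.+1 -> 'I_m.+1 -> C) : linear (bidiff g).
Proof.
move=> c F G; rewrite /bidiff scalerA [c * _]mulrC -scalerA -scalerDr.
congr (_ *: _); rewrite scaler_sumr -big_split; apply: eq_bigr => k _ /=.
rewrite scaler_sumr -big_split; apply: eq_bigr => l _ /=.
rewrite scaler_sumr -big_split; apply: eq_bigr => i _ /=.
by rewrite /dx /dp !linearP.
Qed.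

HB.instance Definition _ m g :=
  GRing.isLinear.Build (Ch R) (chain R r m) (chain R r m) _
    (@bidiff m g) (@bidiff_linear m g).

Lemma bidiff_lowers m (g : 'I_m.+1 -> 'I_m.+1 -> C) : lowers (bidiff g).
Proof.
move=> d F Fd; rewrite /bidiff.
apply: leq_trans (mmeasureZ_le _ _ _) _.
apply: leq_trans (mmeasure_sum _ _ _ _) _; apply/bigmax_leqP => k _.
apply: leq_trans (mmeasure_sum _ _ _ _) _; apply/bigmax_leqP => l _.
apply: leq_trans (mmeasure_sum _ _ _ _) _; apply/bigmax_leqP => i _.
apply: leq_trans (mmeasureZ_le _ _ _) _; rewrite /dx /dp.
by apply: mmeasure_mderiv; apply: leq_trans (leqnSn _); apply: mmeasure_mderiv.
Qed.

Lemma bidiff_mderiv m (g : 'I_m.+1 -> 'I_m.+1 -> C) t F :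
  bidiff g (mderiv t F) = mderiv t (bidiff g F).
Proof.
rewrite /bidiff linearZ /=; congr (_ *: _).
rewrite linear_sum; apply: eq_bigr => k _; rewrite linear_sum.
apply: eq_bigr => l _; rewrite linear_sum; apply: eq_bigr => i _.
by rewrite linearZ /= /dx /dp [in RHS]mderiv_comm (mderiv_comm t).
Qed.

Lemma bidiff_comm m (g g' : 'I_m.+1 -> 'I_m.+1 -> C) F :
  bidiff g (bidiff g' F) = bidiff g' (bidiff g F).
Proof.
rewrite {2 3}/bidiff linearZ /=; congr (_ *: _).
rewrite linear_sum; apply: eq_bigr => k _; rewrite linear_sum.
apply: eq_bigr => l _; rewrite linear_sum; apply: eq_bigr => i _.
by rewrite linearZ /= /dx /dp !bidiff_mderiv.
Qed.

Lemma bidiffD m (g g1 g2 : 'I_m.+1 -> 'I_m.+1 -> C) F :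
  (forall k l, g k l = g1 k l + g2 k l) ->
  bidiff g F = bidiff g1 F + bidiff g2 F.
Proof.
move=> gE; rewrite /bidiff -scalerDr; congr (_ *: _).
rewrite -big_split; apply: eq_bigr => k _ /=.
rewrite -big_split; apply: eq_bigr => l _ /=.
rewrite -big_split; apply: eq_bigr => i _ /=.
by rewrite gE polyCD scalerDl.
Qed.

Lemma eq_bidiff m (g g' : 'I_m.+1 -> 'I_m.+1 -> C) :
  (forall k l, g k l = g' k l) -> @bidiff m g = bidiff g'.
Proof. by move=> gg'; congr bidiff; apply: funext => k; apply: funext. Qed.

Lemma exp_bidiff_mderiv m (g : 'I_m.+1 -> 'I_m.+1 -> C) t F :
  mderiv t (exp_op (bidiff g) F) = exp_op (bidiff g) (mderiv t F).
Proof.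
apply: exp_op_intertwine => [c G H|||G]; first by rewrite linearP.
- exact: bidiff_lowers.
- exact: bidiff_lowers.
- by rewrite bidiff_mderiv.
Qed.

Lemma dxdp_slot_map m m' (s : 'I_m.+1 -> 'I_m'.+1) k l i F :
  dx k i (dp l i (rename (slot_map s) F))
  = \sum_(k' | s k' == k) \sum_(l' | s l' == l)
      rename (slot_map s) (dx k' i (dp l' i F)) :> chain R r m'.
Proof.
rewrite /dp mderiv_slot_map /dx (linear_sum (mderiv _)) exchange_big.
by apply: eq_bigr => l' _ /=; rewrite mderiv_slot_map.
Qed.

(** By the Leibniz rule, a derivative after the identification of slots is the
    sum of the derivatives in the slots identified; hence the kernel is pulled
    back along s. *)
Lemma bidiff_slot_map m m' (s : 'I_m.+1 -> 'I_m'.+1) g F :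
  rename (slot_map s) (bidiff (fun k l => g (s k) (s l)) F)
  = bidiff g (rename (slot_map s) F).
Proof.
rewrite /bidiff linearZ /=; congr (_ *: _).
rewrite (linear_sum (rename _)) (partition_big s xpredT) //=.
apply: eq_bigr => k _.
under [RHS]eq_bigr => l _ do under eq_bigr => i _ do
  rewrite dxdp_slot_map scaler_sumr.
under [RHS]eq_bigr => l _ do rewrite exchange_big.
rewrite [RHS]exchange_big; apply: eq_bigr => k' /eqP sk /=.
rewrite (linear_sum (rename _)) (partition_big s xpredT) //=.
apply: eq_bigr => l _.
under [RHS]eq_bigr => i _ do rewrite scaler_sumr.
rewrite [RHS]exchange_big; apply: eq_bigr => l' /eqP sl /=.
rewrite (linear_sum (rename _)); apply: eq_bigr => i _ /=.
by rewrite linearZ /= sk sl.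
Qed.

(** The kernel of the Moyal product whose left factor is in the slot p and whose
    right factor is in the slot q. *)
Definition moyal_kernel m (p q k l : 'I_m.+1) : C :=
  2^-1 * ((k == p) && (l == q))%:R - 2^-1 * ((k == q) && (l == p))%:R.

Lemma bidiff_moyal_kernel m (p q : 'I_m.+1) F :
  bidiff (moyal_kernel p q) F
  = (2^-1 *: ihbar R) *: \sum_(i < r) (dx p i (dp q i F) - dx q i (dp p i F)).
Proof.
have pick (p' q' : 'I_m.+1) :
    bidiff (fun k l => 2^-1 * ((k == p') && (l == q'))%:R) F
    = (2^-1 *: ihbar R) *: \sum_(i < r) dx p' i (dp q' i F).
  rewrite /bidiff (bigD1 p') //= (bigD1 q') //= !eqxx mulr1.
  rewrite [X in _ + X + _]big1 => [|l /negbTE lq]; last first.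
    by rewrite big1 // => i _; rewrite lq mulr0 scale0r.
  rewrite [X in _ + X]big1 => [|k /negbTE kp]; last first.
    by rewrite big1 // => l _; rewrite big1 // => i _; rewrite kp mulr0 scale0r.
  by rewrite !addr0 -scaler_sumr scalerA mulrC mul_polyC.
rewrite sumrB scalerBr -!pick; apply: (canRL (addrK _)); apply/esym.
by apply: bidiffD => k l; rewrite /moyal_kernel addrNK.
Qed.

Lemma moyal_opE (F : chain R r 1) : moyal_op F = bidiff (moyal_kernel ord0 ord_max) F.
Proof.
rewrite bidiff_moyal_kernel /moyal_op; congr (_ *: _); apply: eq_bigr => i _.
by congr (_ - _); rewrite /dx /dp mderiv_comm.
Qed.

(** Meaningful when s identifies p and q and no other slots: the Moyal product
    of the slot p, on the left, and the slot q. *)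
Definition merge m m' (s : 'I_m.+1 -> 'I_m'.+1) (p q : 'I_m.+1) (F : chain R r m) :
    chain R r m' :=
  rename (slot_map s) (exp_op (bidiff (moyal_kernel p q)) F).

Lemma merge_linear m m' (s : 'I_m.+1 -> 'I_m'.+1) p q : linear (merge s p q).
Proof.
move=> c F G; rewrite /merge exp_op_linear ?linearP //; exact: bidiff_lowers.
Qed.

HB.instance Definition _ m m' (s : 'I_m.+1 -> 'I_m'.+1) p q :=
  GRing.isLinear.Build (Ch R) (chain R r m) (chain R r m') _
    (merge s p q) (@merge_linear m m' s p q).

(** When two neighbouring points collide, Green's function tends to Green's
    function of the configuration with a double point, plus its one-sided limits
    1/2 and -1/2 between the two points, that is, plus the Moyal kernel. The
    exponential of the sum is a product, and the first factor to act is the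
    Moyal product of the two slots. *)
Lemma diagonal_exp_merge m m' (s : 'I_m.+1 -> 'I_m'.+1) p q g g' F :
  (forall k l, g k l = g' (s k) (s l) + moyal_kernel p q k l) ->
  diagonal (exp_op (bidiff g) F) = diagonal (exp_op (bidiff g') (merge s p q F)).
Proof.
move=> gE; pose g1 k l := g' (s k) (s l).
have -> : bidiff g = (fun G => bidiff g1 G + bidiff (moyal_kernel p q) G).
  by apply: funext => G; apply: bidiffD.
rewrite exp_opD; [|by move=> G; exact: bidiff_comm| |]; try exact: bidiff_lowers.
rewrite -(diagonal_slot_map s); congr diagonal.
apply: exp_op_intertwine => [c G H|||G]; first by rewrite linearP.
- exact: bidiff_lowers.
- exact: bidiff_lowers.
- exact: bidiff_slot_map.
Qed.

(** The Moyal product obeys the Leibniz rule for constant vector fields, because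
    its exponent has constant coefficients. *)
Lemma mderiv_merge m m' (s : 'I_m.+1 -> 'I_m'.+1) p q j v F :
  mderiv (slot_var j v) (merge s p q F)
  = \sum_(k | s k == j) merge s p q (mderiv (slot_var k v) F).
Proof.
rewrite /merge mderiv_slot_map; apply: eq_bigr => k _.
by rewrite exp_bidiff_mderiv.
Qed.

(** The slot z is removed and its content moved to the slot y. *)
Definition collapse m (z : 'I_m.+2) (y : 'I_m.+1) (k : 'I_m.+2) : 'I_m.+1 :=
  if unlift z k is Some j then j else y.

Lemma collapse_lift m (z : 'I_m.+2) y j : collapse z y (lift z j) = j.
Proof. by rewrite /collapse liftK. Qed.

Lemma collapse_removed m (z : 'I_m.+2) y : collapse z y z = y.
Proof. by rewrite /collapse unlift_none. Qed.

(** The entries other than a p and a q make up a factor H which involves neither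
    of the slots p and q, hence commutes with their derivatives. So the map T,
    which places a chain with two slots in p and q and multiplies it by H,
    intertwines the exponents of the two exponentials. *)
Lemma pure_tensor_merge m (z : 'I_m.+2) (y : 'I_m.+1) p q
    (a : 'I_m.+2 -> polAh R r) (a' : 'I_m.+1 -> polAh R r) :
  (p = lift z y /\ q = z) \/ (p = z /\ q = lift z y) ->
  a' y = moyal (a p) (a q) -> (forall j, j != y -> a' j = a (lift z j)) ->
  merge (collapse z y) p q (pure_tensor a) = pure_tensor a'.
Proof.
move=> pq a'y a'j; pose e (k : 'I_2) := if k == ord0 then p else q.
have neqpq : p != q.
  by case: pq => [[-> ->]|[-> ->]]; rewrite ?neq_lift // eq_sym neq_lift.
have pq_neq j : j != y -> (lift z j != p) && (lift z j != q).
  move=> jy; have zj : lift z j != z by rewrite eq_sym neq_lift.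
  have yj : lift z j != lift z y by rewrite (inj_eq lift_inj).
  by case: pq => [[-> ->]|[-> ->]]; rewrite zj yj.
have colE k : collapse z y (e k) = y.
  rewrite /e; case: pq => [[-> ->]|[-> ->]]; case: ifP => _;
  by rewrite ?collapse_lift ?collapse_removed.
pose H : chain R r m.+1 := \prod_(j < m.+1 | j != y) in_slot (lift z j) (a (lift z j)).
pose A : chain R r 1 := pure_tensor (fun k : 'I_2 => if k == ord0 then a p else a q).
pose T G : chain R r m.+1 := rename (slot_map e) G * H.
have TA : pure_tensor a = T A.
  have AE : A = in_slot ord0 (a p) * in_slot ord_max (a q) := pure_tensor2 _.
  have eA : rename (slot_map e) A = in_slot p (a p) * in_slot q (a q).
    apply: etrans (congr1 (rename _) AE) _; apply: etrans (renameM _ _ _) _.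
    by congr (_ * _); apply: rename_in_slot.
  by apply: etrans (pure_tensorD2 a pq) _; apply: (congr1 (fun G => G * H)).
have derH k v : mderiv (slot_var (e k) v) H = 0.
  pose dead (G : chain R r m.+1) := mderiv (slot_var (e k) v) G = 0.
  apply: (big_ind dead) => [|G1 G2 d1 d2|j /pq_neq /andP[jp jq]]; rewrite /dead.
  - by rewrite -mpolyC1 mderivC.
  - by rewrite mderivM d1 d2 mul0r mulr0 addr0.
  - rewrite in_slotE mderiv_rename big1 // => w /eqP /slot_var_inj[].
    by move: jp jq; rewrite /e; case: ifP => _ jp jq jE; rewrite jE eqxx in jp jq.
have e_inj : injective e.
  move=> k l; rewrite /e; case: (eqVneq k ord0) => k0; case: (eqVneq l ord0) => l0.
  - by rewrite k0 l0.
  - by move/eqP; rewrite (negbTE neqpq).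
  - by move/eqP; rewrite eq_sym (negbTE neqpq).
  - by move=> _; apply: val_inj; case: k l k0 l0 => [[|[|?]] ?] [[|[|?]] ?].
have derT k v G : mderiv (slot_var (e k) v) (T G) = T (mderiv (slot_var k v) G).
  rewrite /T mderivM derH mulr0 addr0; congr (_ * _).
  by rewrite mderiv_slot_map (eq_bigl (xpred1 k)) ?big_pred1_eq // => l;
     rewrite (inj_eq e_inj).
have linT : linear T.
  by move=> c G1 G2; rewrite /T linearP mulrDl -scalerAl.
pose TL := HB.pack_for {linear chain R r 1 -> chain R r m.+1} T
  (GRing.isLinear.Build _ _ _ _ T linT).
have halfT G : T (bidiff (moyal_kernel ord0 ord_max) G) = bidiff (moyal_kernel p q) (T G).
  have derT2 k v l w : T (mderiv (slot_var k v) (mderiv (slot_var l w) G))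
      = mderiv (slot_var (e k) v) (mderiv (slot_var (e l) w) (T G)).
    exact: esym (etrans (congr1 (mderiv _) (derT l w G)) (derT k v _)).
  rewrite !bidiff_moyal_kernel; apply: etrans (linearZ_LR TL _ _) _.
  congr (_ *: _); apply: etrans (linear_sum TL _ _ _) _.
  apply: eq_bigr => i _; apply: etrans (linearB TL _ _) _.
  exact: (congr2 (fun x y => x - y) (derT2 ord0 _ ord_max _) (derT2 ord_max _ ord0 _)).
have expT : exp_op (bidiff (moyal_kernel p q)) (T A) = T (exp_op (@moyal_op R r) A).
  have -> : @moyal_op R r = bidiff (moyal_kernel ord0 ord_max).
    by apply: funext => G; rewrite moyal_opE.
  apply: esym.
  exact: (exp_op_intertwine A linT (@bidiff_lowers _ _) (@bidiff_lowers _ _) halfT).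
rewrite /merge TA expT /T.
apply: etrans (renameM _ _ _) _; rewrite /pure_tensor (bigD1 y) //=.
apply: (congr2 (fun G1 G2 => G1 * G2)).
  by rewrite a'y; apply: rename_slot_map_const colE.
apply: etrans (rename_prod _ _ _ _) _.
apply: eq_bigr => j jy; rewrite (a'j _ jy).
by apply: etrans (rename_in_slot _ _ _) _; rewrite collapse_lift.
Qed.

End Bidifferential.

(** * Integrals of powers on the circle *)
Section CircleIntegrals.
Variable R : realType.
Local Notation mR := (measurableTypeR R).
Local Notation leb := (@lebesgue_measure R).

Definition cfrac (t s : R) : R := (s - t) - (Num.floor (s - t))%:~R.

Lemma cfrac_itv t s : 0 <= cfrac t s < 1.
Proof.
rewrite /cfrac; have := floor_itv (s - t); rewrite intrD.
by move=> /andP[h1 h2]; apply/andP; split; lra.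
Qed.

Lemma cfrac_unique t s v (z : int) : s - t = v + z%:~R -> 0 <= v < 1 -> cfrac t s = v.
Proof.
move=> st /andP[v0 v1]; rewrite /cfrac.
have -> : Num.floor (s - t) = z.
  by apply: floor_def; rewrite st intrD; apply/andP; split; lra.
by rewrite st addrK.
Qed.

Lemma measurable_natr_bool d (Y : measurableType d) (b : Y -> bool) :
  measurable_fun setT b -> measurable_fun setT (fun y => (b y)%:R : mR).
Proof.
move=> mb; have mN : measurable_fun setT (fun b : bool => b%:R : mR) by [].
exact: measurableT_comp mN mb.
Qed.

Lemma measurable_cfrac d (Y : measurableType d) (c x : Y -> mR) :
  measurable_fun setT c -> measurable_fun setT x ->
  measurable_fun setT (fun y => cfrac (c y) (x y) : mR).
Proof.
move=> mc mx; rewrite /cfrac.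
have mB : measurable_fun setT (fun y => x y - c y : mR) by exact: measurable_funB.
apply: measurable_funB => //.
have mF : measurable_fun setT (fun z : mR => (Num.floor z)%:~R : mR).
  apply: nondecreasing_measurable => // a b ab.
  by rewrite ler_int le_floor.
exact: measurableT_comp mF mB.
Qed.

Lemma ge0_integral_circle (f : mR -> \bar R) :
  measurable_fun setT f -> (forall x, 0 <= f x)%E ->
  (\int[@circle_measure R]_x f x = \int[leb]_(x in `[0%R, 1%R[) f x)%E.
Proof.
move=> mf f0; have mD := @measurable_domain R.
rewrite -(setUv (`[0%R, 1%R[ : set mR)%classic) ge0_integral_setU //=; last 3 first.
- exact: measurableC.
- by apply: measurable_funTS.
- by rewrite disj_set2E setICr.
rewrite -[RHS]adde0; congr (_ + _)%E.
  apply: eq_measure_integral => S mS SD.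
  by rewrite /= /circle_measure /mrestr setIidl.
rewrite -[RHS](integral_measure_zero (~` (`[0%R, 1%R[ : set mR))%classic f).
apply: eq_measure_integral => S mS SD.
rewrite /= /circle_measure /mrestr.
suff -> : (S `&` `[0, 1[ = set0)%classic by rewrite measure0.
by apply/seteqP; split => // x [/SD].
Qed.

Definition primitive N (t : R) : R := t ^+ N.+1 / N.+1%:R.

Lemma integral_power (a b d : R) N : a <= b ->
  (\int[leb]_(x in `]a, b[) ((x - d) ^+ N)%:E
   = (primitive N (b - d) - primitive N (a - d))%:E)%E.
Proof.
rewrite le_eqVlt => /predU1P[->|ab].
  by rewrite subrr set_itvE integral_set0.
pose P : {poly R} := N.+1%:R^-1 *: ('X - d%:P) ^+ N.+1.
have PE x : primitive N (x - d) = P.[x] by rewrite /primitive !hornerE mulrC.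
have P'E x : P^`().[x] = (x - d) ^+ N.
  rewrite derivZ deriv_exp derivXsubC mul1r !hornerE hornerMn !hornerE.
  by rewrite -[(x - d) ^+ _ *+ _]mulr_natl mulKf // pnatr_eq0.
rewrite !PE; under eq_integral => x _ do rewrite -P'E.
rewrite -(@integral_itv_bndoo R a b _ true false); last first.
  apply/measurable_EFinP; apply: measurable_funTS.
  by apply: continuous_measurable_fun; apply: continuous_horner.
rewrite (@continuous_FTC2 _ _ (horner P)) //.
- by apply: continuous_in_subspaceT => x _; exact: continuous_horner.
- split=> [x _||].
  + exact: ex_derive.
  + by apply: cvg_at_right_filter; apply: continuous_horner.
  + by apply: cvg_at_left_filter; apply: continuous_horner.
- by move=> x _; rewrite derive1E derive_val.
Qed.

(** The condition 0 < x - d < l only moves the bounds of the integral. *)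
Lemma integral_power_trunc (a b d l : R) (N : nat) : d <= a -> a <= b -> 0 <= l ->
  (\int[leb]_(x in `[a, b[) ((0 < x - d < l)%R%:R * (x - d) ^+ N)%:E
   = (primitive N (Num.min l (b - d)) - primitive N (Num.min l (a - d)))%:E)%E.
Proof.
move=> da ab l0.
have mB : measurable_fun setT (fun x : mR => x - d : mR) by exact: measurable_funB.
have mf : measurable_fun setT
    (fun x : mR => (0 < x - d < l)%R%:R * (x - d) ^+ N : mR).
  apply: measurable_funM; last exact: measurable_funX.
  by apply: measurable_natr_bool; apply: measurable_and; apply: measurable_fun_ltr.
rewrite (@integral_itv_bndoo R a b _ true true); last first.
  by apply/measurable_EFinP; apply: measurable_funTS.
transitivity (\int[leb]_(x in `]a, b[)
    (((fun x : R => ((x - d) ^+ N)%:E) \_ [set x | (x < d + l)%R])%classic x))%E.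
  apply: eq_integral => x; rewrite inE /= in_itv /= => /andP[ax _].
  have -> /= : 0 < x - d by lra.
  rewrite patchE ltrBlDl; case: ifPn.
    by rewrite inE /= => ->; rewrite mul1r.
  by rewrite notin_setE /= => /negP/negbTE ->; rewrite mul0r.
rewrite -integral_mkcondr.
have -> : (`]a, b[ `&` [set x | x < d + l] = `]a, Num.min b (d + l)[)%classic.
  apply/seteqP; split => x /=; rewrite !in_itv /= lt_min.
    by move=> [/andP[-> ->] ->].
  by move=> /and3P[-> -> ->].
have minE : Num.min l (b - d) = Num.min b (d + l) - d.
  by rewrite -[l in LHS](addKr d) [- d + _]addrC -addr_minl minC.
have [al|la] := leP a (d + l).
  rewrite integral_power; last by rewrite le_min ab.
  rewrite -minE; congr (_ - primitive _ _)%:E.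
  by apply/esym/min_idPr; lra.
rewrite set_itv_ge ?integral_set0; last first.
  by rewrite bnd_simp -leNgt ge_min (ltW la) orbT.
rewrite !min_l ?subrr //; lra.
Qed.

(** The point c cuts the fundamental domain [0, 1[ into two arcs, on each of
    which cfrac c is a translation. The values of the primitive at the seam,
    where 0 and 1 are glued, cancel. *)
Lemma circle_power (c l : R) (N : nat) : 0 <= l <= 1 ->
  (\int[@circle_measure R]_x ((0 < cfrac c x < l)%R%:R * cfrac c x ^+ N)%:E
   = (l ^+ N.+1 / N.+1%:R)%:E)%E.
Proof.
move=> /andP[l0 l1]; pose c' := cfrac 0 c.
have [c0 c1] : 0 <= c' /\ c' < 1 by apply/andP; apply: cfrac_itv.
have cc' : c = c' + (Num.floor c)%:~R by rewrite /c' /cfrac subr0 subrK.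
have mw : measurable_fun setT (fun x : mR => cfrac c x : mR).
  exact: measurable_cfrac.
have mf : measurable_fun setT
    (fun x : mR => ((0 < cfrac c x < l)%R%:R * cfrac c x ^+ N)%:E).
  apply/measurable_EFinP; apply: measurable_funM; last exact: measurable_funX.
  by apply: measurable_natr_bool; apply: measurable_and; apply: measurable_fun_ltr.
have f0 x : (0 <= ((0 < cfrac c x < l)%R%:R * cfrac c x ^+ N)%:E)%E.
  rewrite lee_fin mulr_ge0 ?ler0n // exprn_ge0 //.
  by case/andP: (cfrac_itv c x).
rewrite ge0_integral_circle //.
have -> : (`[0%R, 1%R[ = `[0%R, c'[ `|` `[c', 1%R[ :> set R)%classic.
  apply/seteqP; split => x /=; rewrite !in_itv /=.
    by move=> /andP[x0 x1]; have [xc|cx] := ltP x c'; [left|right]; rewrite ?x0 ?x1.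
  by case=> /andP[h1 h2]; apply/andP; split; lra.
rewrite ge0_integral_setU //=; last 2 first.
- by apply: measurable_funTS.
- apply/disj_setPS => x /= []; rewrite !in_itv /= => /andP[_ h1] /andP[h2 _].
  by move: h1; rewrite ltNge h2.
under [X in (X + _)%E]eq_integral => x.
  rewrite inE /= in_itv /= => /andP[x0 xc].
  have -> : cfrac c x = x - (c' - 1).
    apply: (@cfrac_unique _ _ _ (- Num.floor c - 1)).
      by rewrite intrD rmorphN /= {1}cc'; ring.
    by apply/andP; split; lra.
  over.
under [X in (_ + X)%E]eq_integral => x.
  rewrite inE /= in_itv /= => /andP[cx x1].
  have -> : cfrac c x = x - c'.
    apply: (@cfrac_unique _ _ _ (- Num.floor c)).
      by rewrite rmorphN /= {1}cc'; ring.
    by apply/andP; split; lra.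
  over.
rewrite integral_power_trunc; [|by lra|exact: c0|exact: l0].
rewrite integral_power_trunc; [|exact: lexx|exact: ltW|exact: l0].
rewrite -EFinD; congr EFin; rewrite subrr.
have -> : c' - (c' - 1) = 1 by ring.
have -> : 0 - (c' - 1) = 1 - c' by ring.
rewrite (min_l l1) (min_r l0) addrA subrK /primitive.
by rewrite [0 ^+ _]expr0n /= mul0r subr0.
Qed.

End CircleIntegrals.

(** * Moments on the torus *)
Section TorusMoments.
Variable R : realType.
Local Notation mR := (measurableTypeR R).

(** With w_i = cfrac c s_i, this is w_1^e_1 w_2^e_2 ... times the indicator of
    l > w_1 > w_2 > ... > 0. The recursion is that of an iterated integral: once
    the first point is fixed, w_1 is the bound for the remaining ones. *)
Fixpoint simplex_mon (e : seq nat) (c l : R) (s : seq R) : R :=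
  match e, s with
  | k :: e', x :: s' =>
      (0 < cfrac c x < l)%R%:R * cfrac c x ^+ k * simplex_mon e' c (cfrac c x) s'
  | _, _ => 1
  end.

Definition simplex_deg (e : seq nat) : nat := sumn (map S e).

(** The integral of w_1^e_1 w_2^e_2 ... over 1 > w_1 > w_2 > ... > 0; the
    denominators are the degrees, as each integration raises the degree by 1. *)
Fixpoint simplex_moment (F : fieldType) (e : seq nat) : F :=
  if e is k :: e' then simplex_moment F e' / (simplex_deg e)%:R else 1.

Lemma simplex_mon_ge0 e c l s : 0 <= simplex_mon e c l s.
Proof.
elim: e l s => [|k e IH] l [|x s] //=.
rewrite !mulr_ge0 ?ler0n // exprn_ge0 //.
by case/andP: (cfrac_itv c x).
Qed.

Lemma measurable_simplex_mon d (Y : measurableType d) e (c l : Y -> mR)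
    (s : Y -> (size e).-tuple mR) :
  measurable_fun setT c -> measurable_fun setT l -> measurable_fun setT s ->
  measurable_fun setT (fun y => simplex_mon e (c y) (l y) (s y) : mR).
Proof.
move=> mc; elim: e l s => [|k e IH] l s ml ms /=; first exact: measurable_cst.
pose x y := thead (s y).
have mx : measurable_fun setT (x : Y -> mR).
  exact: (measurableT_comp (@measurable_tnth _ mR _ ord0) ms).
have mt : measurable_fun setT (fun y => [tuple of behead (s y)] : _.-tuple mR).
  exact: (measurableT_comp (@measurable_behead _ mR _) ms).
have mw := measurable_cfrac mc mx.
have -> : (fun y => match s y : seq R with
       | [::] => 1
       | x :: s' => (0 < cfrac (c y) x < l y)%R%:R * cfrac (c y) x ^+ k *
                    simplex_mon e (c y) (cfrac (c y) x) s'
       end)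
    = (fun y => (0 < cfrac (c y) (x y) < l y)%R%:R * cfrac (c y) (x y) ^+ k
      * simplex_mon e (c y) (cfrac (c y) (x y)) [tuple of behead (s y)]).
  by apply: funext => y; rewrite [in LHS](tuple_eta (s y)).
apply: measurable_funM; last exact: IH.
apply: measurable_funM; last exact: measurable_funX.
by apply: measurable_natr_bool; apply: measurable_and; apply: measurable_fun_ltr.
Qed.

(** By Tonelli's theorem one may integrate over the points after the first one
    to begin with. By homogeneity this gives a power of w_1, and circle_power
    does the last integral. *)
Lemma torus_moment e (c l : R) : 0 <= l <= 1 ->
  (\int[torus_measure R (size e)]_t (simplex_mon e c l t)%:E
   = (simplex_moment R e * l ^+ simplex_deg e)%:E)%E.
Proof.
elim: e l => [|k e IH] l l01.
  rewrite /= integral_dirac //=.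
  by rewrite diracT mul1e mul1r.
have [l0 l1] := andP l01.
rewrite [torus_measure _ _]/=.
have mH : measurable_fun setT
    (fun t : (size e).+1.-tuple mR => (simplex_mon (k :: e) c l t)%:E).
  apply/measurable_EFinP.
  exact: (@measurable_simplex_mon _ _ (k :: e)).
have H0 t : (0 <= (simplex_mon (k :: e) c l t)%:E)%E.
  by rewrite lee_fin simplex_mon_ge0.
rewrite (ge0_integral_distribution _ mH) //.
rewrite fubini_tonelli1; last 2 first.
- exact: (measurableT_comp mH (@measurable_tcons R (size e))).
- by move=> x; apply: H0.
pose N := (k + simplex_deg e)%N.
transitivity (\int[@circle_measure R]_x
   ((simplex_moment R e)%:E * ((0 < cfrac c x < l)%R%:R * cfrac c x ^+ N)%:E))%E.
  apply: eq_integral => x _; rewrite /fubini_F /=.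
  have [w0 w1] := andP (cfrac_itv c x).
  under eq_integral => t _ do rewrite EFinM.
  rewrite ge0_integralZl_EFin //=; last 3 first.
  - by move=> t _; rewrite lee_fin simplex_mon_ge0.
  - by apply/measurable_EFinP; apply: measurable_simplex_mon.
  - by rewrite mulr_ge0 ?ler0n // exprn_ge0.
  rewrite IH ?w0 ?ltW // -!EFinM; congr EFin.
  by rewrite /N exprD; ring.
rewrite ge0_integralZl_EFin //; last 3 first.
- move=> x _; rewrite lee_fin mulr_ge0 ?ler0n // exprn_ge0 //.
  by case/andP: (cfrac_itv c x).
- apply/measurable_EFinP; have mw : measurable_fun setT (fun x : mR => cfrac c x : mR).
    exact: measurable_cfrac.
  apply: measurable_funM; last exact: measurable_funX.
  by apply: measurable_natr_bool; apply: measurable_and; apply: measurable_fun_ltr.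
- elim: (e) => //= k' e' IHe; rewrite mulr_ge0 // invr_ge0 ler0n //.
rewrite circle_power // -EFinM; congr EFin.
by rewrite /simplex_deg /= -/(simplex_deg e) addSn -/N mulrA mulrAC.
Qed.

End TorusMoments.

(** * Cyclic configurations and their gaps *)
Section CyclicConfigurations.
Variable R : realType.
Local Notation mR := (measurableTypeR R).

Definition gap m (th : m.+1.-tuple mR) (i : 'I_m) : R :=
  cfrac (tnth th ord0) (tnth th (lift ord0 i)).

(** The gaps, preceded by 1. Although theta_0 is at distance 0 from itself, its
    level is 1, so that the levels of a cyclic configuration decrease. *)
Definition level (F : pzRingType) m (u : 'I_m -> F) (k : 'I_m.+1) : F :=
  oapp u 1 (unlift ord0 k).

Lemma level0 (F : pzRingType) m (u : 'I_m -> F) : level u ord0 = 1.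
Proof. by rewrite /level unlift_none. Qed.

Lemma level_lift (F : pzRingType) m (u : 'I_m -> F) i : level u (lift ord0 i) = u i.
Proof. by rewrite /level liftK. Qed.

Lemma level_mod m (th : m.+1.-tuple mR) k :
  exists z : int, tnth th k - tnth th ord0 = level (gap th) k + z%:~R.
Proof.
case: (unliftP ord0 k) => [i|] ->.
  exists (Num.floor (tnth th (lift ord0 i) - tnth th ord0)).
  by rewrite level_lift /gap /cfrac subrK.
by exists (-1); rewrite level0 subrr rmorphN /= addrN.
Qed.

Definition decreasing_levels m (th : m.+1.-tuple mR) :=
  (forall k l : 'I_m.+1, (k < l)%N -> level (gap th) l < level (gap th) k)
  /\ (forall k, 0 < level (gap th) k).

(** The lifts theta_0 - 1 + level k show that the configuration is cyclic.
    Conversely the lifts of a cyclic configuration lie in an interval of length 1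
    whose largest point is the lift of theta_0, so they are of this form up to a
    translation. *)
Lemma cycP m (th : m.+1.-tuple mR) : cyc th <-> decreasing_levels th.
Proof.
split=> [[z]|[decr pos]]; last first.
  have hz k : exists z : int,
      tnth th k + z%:~R = tnth th ord0 + level (gap th) k - 1.
    have [z hz] := level_mod th k; exists (- z - 1).
    by rewrite intrD !rmorphN /=; move: hz; lra.
  exists (fun k => projT1 (cid (hz k))); set t := (fun k => _).
  have tE k : t k = tnth th ord0 + level (gap th) k - 1.
    by rewrite /t; case: cid.
  split=> [k l kl|]; rewrite !tE; first by have := decr _ _ kl; lra.
  by rewrite level0; have := pos ord_max; lra.
set t := (fun k => _) => -[decr wrap].
have t_max k : t ord_max <= t k.
  have [-> //|km] := eqVneq k ord_max.
  by apply/ltW/decr; rewrite ltn_neqAle leq_ord andbT; exact: km.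
have levelE k : level (gap th) k = t k - t ord0 + 1.
  case: (unliftP ord0 k) => [i ki|->]; last by rewrite level0 subrr add0r.
  rewrite ki level_lift /gap -ki.
  apply: (@cfrac_unique _ _ _ _ (z ord0 - z k - 1)).
    by rewrite /t !intrD !rmorphN /=; ring.
  have := t_max k; have : t k < t ord0 by apply: decr; rewrite ki.
  by move=> h1 h2; apply/andP; split; lra.
split=> [k l /decr|k]; rewrite !levelE; first by lra.
by have := t_max k; lra.
Qed.

(** The part of Green's function that does not depend on the gaps. *)
Definition orient (F : fieldType) m (k l : 'I_m.+1) : F :=
  if (k < l)%N then 2^-1 else if (l < k)%N then - 2^-1 else 0.

(** The difference level l - level k lies strictly between -1 and 1, and its sign
    is known from the order of k and l. So theta_l - theta_k has this difference,
    or the difference plus 1, as its representative between 0 and 1. *)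
Lemma green_cyc m (th : m.+1.-tuple mR) k l : cyc th ->
  green (tnth th k) (tnth th l)
  = orient R k l + level (gap th) l - level (gap th) k.
Proof.
move=> /cycP[decr pos].
have le1 j : level (gap th) j <= 1.
  have [->|j0] := eqVneq j ord0; first by rewrite level0.
  rewrite -(level0 (gap th)); apply/ltW/decr.
  by rewrite lt0n -(inj_eq val_inj) in j0 *.
have [zk hk] := level_mod th k; have [zl hl] := level_mod th l.
have diffE : tnth th l - tnth th k = (level (gap th) l - level (gap th) k) + (zl - zk)%:~R.
  by rewrite intrD rmorphN /=; move: hk hl; lra.
rewrite /green -/(cfrac _ _) /orient.
have [kl|lk|/val_inj ->] := ltngtP k l.
- have := decr _ _ kl; have := pos l; have := le1 k => h1 h2 h3.
  have -> : cfrac (tnth th k) (tnth th l)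
            = level (gap th) l - level (gap th) k + 1.
    apply: (@cfrac_unique _ _ _ _ (zl - zk - 1)).
      by rewrite diffE !intrD !rmorphN /=; ring.
    by apply/andP; split; lra.
  rewrite ifF; first by field.
  by apply/negbTE; rewrite gt_eqF //; lra.
- have := decr _ _ lk; have := pos k; have := le1 l => h1 h2 h3.
  have -> : cfrac (tnth th k) (tnth th l) = level (gap th) l - level (gap th) k.
    apply: (@cfrac_unique _ _ _ _ (zl - zk)); first by [].
    by apply/andP; split; lra.
  rewrite ifF; first by ring.
  by apply/negbTE; rewrite gt_eqF //; lra.
- have -> : cfrac (tnth th l) (tnth th l) = 0.
    by apply: (@cfrac_unique _ _ _ _ 0); rewrite ?lexx ?ltr01 // subrr addr0.
  by rewrite eqxx; ring.
Qed.

Definition mnm_seq m (e : multinom m) : seq nat := [seq e i | i <- enum 'I_m].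

Lemma size_mnm_seq m (e : multinom m) : size (mnm_seq e) = m.
Proof. by rewrite size_map size_enum_ord. Qed.

Lemma simplex_monE e (c l : R) s : size e = size s ->
  simplex_mon e c l s
  = (path (fun a b : R => 0 < b < a)%R l (map (cfrac c) s))%:R
    * \prod_(i < size e) nth 0 (map (cfrac c) s) i ^+ nth 0%N e i.
Proof.
elim: e l s => [|k e IH] l [|x s] //= => [_|[szes]].
  by rewrite big_ord0 mulr1.
rewrite IH // big_ord_recl /= -!mulnb !natrM !mulrA; congr (_ * _).
by rewrite mulrAC.
Qed.

Lemma path_decreasing_levels m (th : m.+1.-tuple mR) :
  reflect (decreasing_levels th)
    (path (fun a b : R => 0 < b < a)%R 1 (map (cfrac (tnth th ord0)) (behead th))).
Proof.
set r := (fun a b : R => _); set ws := map _ _.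
have tr : transitive r.
  by move=> b a c /andP[b0 ba] /andP[c0 cb]; rewrite /r c0 (lt_trans cb ba).
have sz : size (1 :: ws) = m.+1 by rewrite /= size_map size_behead size_tuple.
have nthE (k : 'I_m.+1) : nth 0 (1 :: ws) k = level (gap th) k.
  case: (unliftP ord0 k) => [i ->|->]; last by rewrite level0.
  rewrite level_lift /gap (_ : nth 0 (1 :: ws) _ = nth 0 ws i) //.
  rewrite (nth_map 0) ?size_behead ?size_tuple ?ltn_ord //.
  by rewrite nth_behead [tnth th (lift ord0 i)](tnth_nth 0).
change (reflect (decreasing_levels th) (sorted r (1 :: ws))).
rewrite (sorted_pairwise tr); apply: (iffP (pairwiseP 0)).
  rewrite sz => H; split=> [k l kl|k].
    have := H k l (ltn_ord k) (ltn_ord l) kl; rewrite /= -/(nth _ (1 :: ws) _) !nthE.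
    by case/andP.
  have [->|k0] := eqVneq k ord0; first by rewrite level0.
  have k0' : (0 < k)%N by rewrite lt0n.
  have := H 0%N k isT (ltn_ord k) k0'.
  by rewrite [nth 0 (1 :: ws) k]nthE => /andP[].
move=> [decr pos] i j; rewrite !inE sz => im jm ij.
have := nthE (Ordinal im); have := nthE (Ordinal jm) => /= -> ->.
by rewrite /r pos decr.
Qed.

Lemma simplex_mon_cyc m (e : multinom m) (th : m.+1.-tuple mR) :
  simplex_mon (mnm_seq e) (tnth th ord0) 1 (behead th)
  = \1_(@cyc R m) th * \prod_(i < m) gap th i ^+ e i.
Proof.
rewrite simplex_monE ?size_mnm_seq ?size_behead ?size_tuple //; congr (_ * _).
  rewrite indicE; congr (_%:R); congr nat_of_bool.
  apply/path_decreasing_levels/idP; first by move=> /cycP; rewrite inE.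
  by rewrite inE => /cycP.
apply: eq_bigr => i _.
rewrite (nth_map 0) ?size_behead ?size_tuple // nth_behead.
rewrite (nth_map i) ?size_enum_ord // nth_ord_enum; congr (_ ^+ _).
by rewrite /gap [tnth th (lift _ _)](tnth_nth 0).
Qed.

Lemma measurable_cyc_mon m (e : multinom m) :
  measurable_fun setT
    (fun th : m.+1.-tuple mR =>
       simplex_mon (mnm_seq e) (tnth th ord0) 1 (behead th) : mR).
Proof.
(* The number of points has to be the length of the sequence of exponents. *)
move: (mnm_seq e) (size_mnm_seq e) => s sz.
case: m / sz e => _.
apply: (@measurable_simplex_mon R _ _ s (fun th : (size s).+1.-tuple mR => tnth th ord0)
  (cst 1) (fun th => [tuple of behead th])).
- exact: measurable_tnth.
- exact: measurable_cst.
- exact: measurable_behead.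
Qed.

(** The indicator function of Cyc is [simplex_mon] with exponents 0. *)
Lemma measurable_cyc m : measurable (@cyc R m).
Proof.
pose e : multinom m := mnm0.
have mf := measurable_cyc_mon e.
have -> : @cyc R m = ((fun th : m.+1.-tuple mR =>
       simplex_mon (mnm_seq e) (tnth th ord0) 1 (behead th) : mR) @^-1` [set 1])%classic.
  apply/seteqP; split=> th /=; rewrite simplex_mon_cyc.
    rewrite indicE big1 => [thc|i _]; last by rewrite mnm0E.
    by rewrite mem_set // mulr1.
  rewrite indicE; case: (boolP (th \in _)); first by rewrite inE.
  by rewrite mul0r => _ /esym/eqP; rewrite oner_eq0.
rewrite -[X in measurable X]setTI; apply: mf => //.
Qed.

(** Integrating over theta_0 last: by invariance under rotations the inner
    integral does not depend on it, and the circle has length 1. *)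
Lemma torus_moment_cyc m (e : multinom m) :
  (\int[torus_measure R m.+1]_(th in @cyc R m) (\prod_(i < m) gap th i ^+ e i)%:E
   = (simplex_moment R (mnm_seq e))%:E)%E.
Proof.
rewrite integral_mkcond.
transitivity (\int[torus_measure R m.+1]_th
   (simplex_mon (mnm_seq e) (tnth th ord0) 1 (behead th))%:E)%E.
  apply: eq_integral => th _; rewrite simplex_mon_cyc patchE indicE.
  by case: ifP => _; rewrite ?mul1r ?mul0r.
have mH := measurable_cyc_mon e.
move: (mnm_seq e) (size_mnm_seq e) mH => s sz; case: m / sz e => _ mH.
have mE : measurable_fun setT (fun th : (size s).+1.-tuple mR =>
    (simplex_mon s (tnth th ord0) 1 (behead th))%:E) by apply/measurable_EFinP.
have H0 (th : (size s).+1.-tuple mR) :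
    (0 <= (simplex_mon s (tnth th ord0) 1 (behead th))%:E)%E.
  by rewrite lee_fin simplex_mon_ge0.
rewrite [torus_measure _ _]/= (ge0_integral_distribution _ mE) //.
rewrite fubini_tonelli1; last 2 first.
- exact: (measurableT_comp mE (@measurable_tcons R (size s))).
- by move=> x; apply: H0.
transitivity (\int[@circle_measure R]_x (cst (simplex_moment R s)%:E) x)%E.
  apply: eq_integral => x _; rewrite /fubini_F /=.
  rewrite torus_moment ?ler01 ?lexx // expr1n mulr1 //.
by rewrite integral_cst // (_ : _ [set: mR]%classic = 1%E) ?mule1 //; apply: circle_measureT.
Qed.

End CyclicConfigurations.

(** * The Stokes formula on the simplex *)

(** The support depends on P, but over all monomials of bounded degree the sum
    is visibly linear. *)
Lemma msupp_sum_linear (K : comNzRingType) n (V : lmodType K) (g : multinom n -> V) :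
  linear (fun P : mpoly n K => \sum_(e <- msupp P) mcoeff e P *: g e).
Proof.
have bounded (k : nat) (P : mpoly n K) : (msize P <= k)%N ->
    \sum_(e <- msupp P) mcoeff e P *: g e
    = \sum_(e : bmultinom n k) mcoeff e P *: g e.
  move=> Pk; rewrite (ssrcomplements.big_mksub (bmultinom n k)) /=; first last.
  - by move=> x /msize_mdeg_lt/leq_trans/(_ Pk).
  - by rewrite msupp_uniq.
  by rewrite big_rmcond //= => e /memN_msupp_eq0 ->; rewrite scale0r.
move=> c P Q; pose k := maxn (msize (c *: P + Q)) (maxn (msize P) (msize Q)).
rewrite !(bounded k) ?leq_max ?leqnn ?orbT // scaler_sumr -big_split.
by apply: eq_bigr => e _; rewrite mcoeffD mcoeffZ scalerDl scalerA.
Qed.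

Section SimplexMoments.
Variable F : numFieldType.

Definition tail_sum m (e : 'I_m -> nat) (i : nat) : nat :=
  \sum_(j < m | (i <= j)%N) (e j).+1.

Lemma simplex_moment_prod m (e : 'I_m -> nat) :
  simplex_moment F [seq e i | i <- enum 'I_m]
  = \prod_(i < m) ((tail_sum e i)%:R)^-1.
Proof.
elim: m e => [|m IH] e; first by rewrite big_ord0 enum_ord0.
rewrite enum_ordSl /= -map_comp IH mulrC big_ord_recl; congr (_ * _).
  congr (_%:R^-1); rewrite /simplex_deg /tail_sum big_ord_recl /=; congr addn.
  by rewrite sumnE !big_map [index_enum _]unlock.
apply: eq_bigr => i _; congr (_%:R^-1).
by rewrite /tail_sum [RHS]big_mkcond big_ord_recl /= add0n -big_mkcond.
Qed.

(** The tail sums of the exponents, the l-th exponent being left out. *)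
Definition other_tails m (l : 'I_m.+1) (e : 'I_m.+1 -> nat) (i : nat) : nat :=
  \sum_(j < m | (i <= lift l j)%N) (e (lift l j)).+1.

(** The moment of the exponents in which e l has been added to the preceding
    exponent, or just dropped when l is the first index. *)
Definition merged_moment m (l : 'I_m.+1) (e : 'I_m.+1 -> nat) : F :=
  \prod_(i < m) ((other_tails l e (lift l i) + (i < l) * e l)%:R)^-1.

Section Merge.
Variables (m : nat) (l : 'I_m.+1) (e : 'I_m.+1 -> nat).
Local Notation rest := (other_tails l e).
Local Notation others := (merged_moment l e).

Lemma leq_lift2 (i j : 'I_m) : (lift l i <= lift l j)%N = (i <= j)%N.
Proof. by rewrite /= leq_bump2. Qed.

Lemma lift_leq (i : 'I_m) : (lift l i <= l)%N = (i < l)%N.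
Proof. by rewrite /= /bump; case: (leqP l i) => h; lia. Qed.

Lemma tail_sum_drop (a : 'I_m -> nat) (i : 'I_m) :
  (forall j, a j = e (lift l j)) -> tail_sum a i = rest (lift l i).
Proof.
move=> ae; rewrite /tail_sum /other_tails; apply: eq_big => j; first by rewrite leq_lift2.
by rewrite ae.
Qed.

Lemma tail_sum_add (a : 'I_m -> nat) (j0 : 'I_m) k (i : 'I_m) :
  (forall j, a j = e (lift l j) + k * (j0 == j))%N ->
  tail_sum a i = (rest (lift l i) + (i <= j0) * k)%N.
Proof.
move=> ae; rewrite -(@tail_sum_drop (fun j => e (lift l j))) // /tail_sum.
under eq_bigr => j _ do rewrite ae -addSn.
rewrite big_split /=; congr addn; rewrite big_mkcond (bigD1 j0) //= big1.
  by rewrite eqxx muln1 addn0; case: leqP; rewrite ?mul1n.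
by move=> j /negbTE; rewrite eq_sym => ->; rewrite muln0 if_same.
Qed.

Lemma simplex_moment_lower (a : 'I_m.+1 -> nat) : (0 < e l)%N ->
  (forall j, a (lift l j) = e (lift l j)) -> a l = (e l).-1 ->
  simplex_moment F [seq a i | i <- enum 'I_m.+1]
  = others / (rest l + e l)%:R.
Proof.
move=> el ae al; rewrite simplex_moment_prod (bigD1_ord l) // mulrC.
have tailE (i : 'I_m.+1) : tail_sum a i = (rest i + (i <= l) * e l)%N.
  rewrite /tail_sum big_mkcond (bigD1_ord l) //= -big_mkcond addnC; congr addn.
    by apply: eq_bigr => j _; rewrite ae.
  by rewrite al prednK //; case: leqP; rewrite ?mul1n.
rewrite tailE leqnn mul1n; congr (_ * _); apply: eq_bigr => i _.
by rewrite tailE lift_leq.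
Qed.

Lemma simplex_moment_drop (a : 'I_m -> nat) : l = ord0 ->
  (forall j, a j = e (lift l j)) ->
  simplex_moment F [seq a i | i <- enum 'I_m] = others.
Proof.
move=> l0 ae; rewrite simplex_moment_prod; apply: eq_bigr => i _.
by rewrite (tail_sum_drop _ ae) [X in (_ < nat_of_ord X)%N]l0 /= mul0n addn0.
Qed.

Lemma simplex_moment_up (a : 'I_m -> nat) (j0 : 'I_m) : l = lift ord0 j0 ->
  (forall j, a j = e (lift l j) + e l * (j0 == j))%N ->
  simplex_moment F [seq a i | i <- enum 'I_m] = others.
Proof.
move=> lj ae; rewrite simplex_moment_prod; apply: eq_bigr => i _.
by rewrite (tail_sum_add _ ae) [X in (_ < nat_of_ord X)%N]lj /= ltnS.
Qed.

Lemma simplex_moment_down (a : 'I_m -> nat) (j0 : 'I_m) : l = lift ord_max j0 -> (0 < e l)%N ->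
  (forall j, a j = e (lift l j) + e l * (j0 == j))%N ->
  simplex_moment F [seq a i | i <- enum 'I_m]
  = others * (rest l)%:R / (rest l + e l)%:R.
Proof.
move=> lj el ae; rewrite simplex_moment_prod /merged_moment (bigD1 j0) // [in RHS](bigD1 j0) //.
have lj' : l = j0 :> nat by rewrite lj lift_max.
have restE : rest (lift l j0) = rest l.
  apply: eq_bigl => j; rewrite /= /bump lj' leqnn.
  case: (leqP j0 j) => h; rewrite ?add1n ?add0n ?ltnS; first by rewrite h leqW.
  by rewrite ltnNge (ltnW h) leqNgt h.
have rest0 : (rest l)%:R != 0 :> F.
  rewrite pnatr_eq0 -lt0n /other_tails (bigD1 j0) //=.
  by rewrite /bump lj' leqnn add1n leqnSn.
have reste0 : (rest l + e l)%:R != 0 :> F by rewrite pnatr_eq0 addn_eq0 negb_and -!lt0n el orbT.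
rewrite (tail_sum_add _ ae) leqnn mul1n restE lj' ltnn mul0n addn0.
rewrite (eq_bigr (fun i => (rest (lift l i) + (i < j0) * e l)%:R^-1)); last first.
  by move=> i /= ij; rewrite (tail_sum_add _ ae) ltn_neqAle (inj_eq val_inj) ij.
rewrite /=; set b := \prod_(i < m | _) _; move: rest0 reste0 b; rewrite lj'.
move: (rest j0)%:R (rest j0 + e l)%:R => x y x0 y0 b.
by field; rewrite x0 y0.
Qed.

Lemma rest_bottom : l = ord_max -> rest l = 0%N.
Proof.
move=> lm; rewrite /other_tails big1 // => j; rewrite lm lift_max /=.
by rewrite leqNgt ltn_ord.
Qed.

End Merge.
End SimplexMoments.

Section SimplexIntegral.
Variables (F : numFieldType) (K : comNzRingType) (iota : {rmorphism F -> K}).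

Definition simplex_int m (P : mpoly m K) : K :=
  \sum_(e <- msupp P) mcoeff e P * iota (simplex_moment F (mnm_seq e)).

Lemma simplex_int_linear m : linear (@simplex_int m : mpoly m K -> K^o).
Proof.
exact: (msupp_sum_linear (fun e => iota (simplex_moment F (mnm_seq e)) : K^o)).
Qed.

HB.instance Definition _ m :=
  GRing.isLinear.Build K (mpoly m K) K^o _ (@simplex_int m) (@simplex_int_linear m).

Lemma simplex_intZ m c (P : mpoly m K) : simplex_int (c *: P) = c * simplex_int P.
Proof. exact: (linearZ_LR (@simplex_int m)). Qed.

Lemma simplex_intX m (e : multinom m) :
  simplex_int (mpolyX K e) = iota (simplex_moment F (mnm_seq e)).
Proof. by rewrite /simplex_int msuppX big_seq1 mcoeffX eqxx mul1r. Qed.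

(** The restriction to the hyperplane u_l = v, with the other u_i as
    coordinates. *)
Definition face m (l : 'I_m.+1) (v : mpoly m K) : mpoly m.+1 K -> mpoly m K :=
  comp_mpoly [tuple oapp (fun j => mpolyX K (mnm1 j)) v (unlift l i) | i < m.+1].

Lemma face_linear m (l : 'I_m.+1) v : linear (face l v).
Proof. by move=> c P Q; rewrite /face linearP. Qed.

HB.instance Definition _ m (l : 'I_m.+1) v :=
  GRing.isLinear.Build K (mpoly m.+1 K) (mpoly m K) _ (face l v) (@face_linear m l v).

Lemma meval_face m (l : 'I_m.+1) v u (P : mpoly m.+1 K) :
  meval u (face l v P) = meval (fun i => oapp u (meval u v) (unlift l i)) P.
Proof.
rewrite /face comp_mpoly_meval; apply: meval_eq => i.
by rewrite tnth_mktuple; case: unlift => //= j; rewrite mevalXU.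
Qed.

Definition drop_mnm m (l : 'I_m.+1) (e : multinom m.+1) : multinom m :=
  Multinom [tuple e (lift l j) | j < m].

Lemma faceX m (l : 'I_m.+1) v (e : multinom m.+1) :
  face l v (mpolyX K e) = v ^+ e l * mpolyX K (drop_mnm l e).
Proof.
rewrite /face comp_mpolyX (bigD1_ord l) // tnth_mktuple unlift_none /=.
congr (_ * _); rewrite mpolyXE_id; apply: eq_bigr => j _.
by rewrite tnth_mktuple liftK /= mnmE.
Qed.

(** The bounds of u_l in the simplex when the other coordinates are fixed. *)
Definition upper_neighbour m (l : 'I_m.+1) : mpoly m K :=
  oapp (fun j => mpolyX K (mnm1 j)) 1 (unlift ord0 l).
Definition lower_neighbour m (l : 'I_m.+1) : mpoly m K :=
  oapp (fun j => mpolyX K (mnm1 j)) 0 (unlift ord_max l).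

(** By linearity this is a statement about monomials. Let b be the moment in
    which e_l has been added to the preceding exponent, and x the sum of the
    e_j + 1 for j > l. Then the upper face contributes b, the lower face
    b x / (x + e_l), and the derivative has the integral b e_l / (x + e_l). *)
Lemma simplex_stokes m (l : 'I_m.+1) (P : mpoly m.+1 K) :
  simplex_int (mderiv l P) = simplex_int (face l (upper_neighbour l) P)
                             - simplex_int (face l (lower_neighbour l) P).
Proof.
have mul_neighbour (e : multinom m.+1) j k :
    simplex_int (mpolyX K (mnm1 j) ^+ k * mpolyX K (drop_mnm l e))
    = iota (simplex_moment F
        [seq (e (lift l j') + k * (j == j'))%N | j' <- enum 'I_m]).
  rewrite mpolyXn -mpolyXD simplex_intX /mnm_seq; congr (iota (simplex_moment F _)).
  apply: eq_map => j'; rewrite mnmDE mulmnE mnm1E mnmE addnC.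
  by rewrite [(_ * k)%N]mulnC.
have stokesX (e : multinom m.+1) :
    simplex_int (mderiv l (mpolyX K e))
    = simplex_int (face l (upper_neighbour l) (mpolyX K e))
      - simplex_int (face l (lower_neighbour l) (mpolyX K e)).
  rewrite mderivX !faceX.
  have [el0|el0] := eqVneq (e l) 0%N.
    by rewrite el0 scale0r !expr0 subrr raddf0.
  have el : (0 < e l)%N by rewrite lt0n.
  have -> : simplex_int (upper_neighbour l ^+ e l * mpolyX K (drop_mnm l e))
            = iota (merged_moment F l e).
    rewrite /upper_neighbour; case: unliftP => [j lj|l0] /=.
      by rewrite mul_neighbour; congr (iota _); apply: (simplex_moment_up _ lj).
    rewrite expr1n mul1r simplex_intX; congr (iota _).
    by apply: (simplex_moment_drop _ l0) => j; rewrite mnmE.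
  have -> : simplex_int (lower_neighbour l ^+ e l * mpolyX K (drop_mnm l e))
            = iota (merged_moment F l e * (other_tails l e l)%:R
                    / (other_tails l e l + e l)%:R).
    rewrite /lower_neighbour; case: unliftP => [j lj|lm] /=.
      by rewrite mul_neighbour; congr (iota _); apply: (simplex_moment_down _ lj).
    rewrite expr0n (negbTE el0) mul0r raddf0 rest_bottom //.
    by rewrite mulr0 mul0r rmorph0.
  rewrite simplex_intZ simplex_intX.
  rewrite (simplex_moment_lower F el) => [|j|]; last first.
  - by rewrite mnmBE mnm1E eqxx subn1.
  - by rewrite mnmBE mnm1E (negbTE (neq_lift _ _)) subn0.
  rewrite -rmorphB -[_%:R](rmorph_nat iota) -rmorphM; congr (iota _).
  have : (other_tails l e l + e l)%:R != 0 :> F.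
    by rewrite pnatr_eq0 addn_eq0 negb_and (negbTE el0) orbT.
  rewrite natrD; move: (merged_moment F l e) => b.
  by move: (other_tails l e l)%:R (e l)%:R => x y xy; field.
rewrite [P]mpolyE (linear_sum (mderiv l)) !(linear_sum (face _ _)).
rewrite !(linear_sum (@simplex_int _)) -sumrB; apply: eq_bigr => e _.
by rewrite !linearZ /= stokesX scalerBr.
Qed.

End SimplexIntegral.

(** * Integrals over cyclic configurations *)
Lemma mcoeffMC (K : comNzRingType) n (a : multinom n) (P : mpoly n K) c :
  mcoeff a (P * mpolyC n c) = mcoeff a P * c.
Proof. by rewrite mulrC mcoeffCM mulrC. Qed.

Section CyclicIntegral.
Variable R : realType.
Local Notation mR := (measurableTypeR R).
Local Notation C := R[i].
Local Open Scope classical_set_scope.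

Definition gap_mon m (e : multinom m) (th : m.+1.-tuple mR) : R :=
  \prod_(i < m) gap th i ^+ e i.

Lemma gap_mon_ge0 m (e : multinom m) th : 0 <= gap_mon e th.
Proof.
apply: prodr_ge0 => i _; rewrite exprn_ge0 //.
by case/andP: (cfrac_itv (tnth th ord0) (tnth th (lift ord0 i))).
Qed.

Lemma measurable_gap_mon m (e : multinom m) :
  measurable_fun setT (gap_mon e : _ -> mR).
Proof.
apply: measurable_prod => i _; apply: measurable_funX.
by apply: measurable_cfrac; apply: measurable_tnth.
Qed.

Local Notation mu m := (torus_measure R m.+1).

Lemma integrable_gap_mon m (e : multinom m) :
  (mu m).-integrable (@cyc R m) (EFin \o gap_mon e).
Proof.
apply/integrableP; split.
  by apply/measurable_EFinP; apply: measurable_funTS; apply: measurable_gap_mon.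
under eq_integral => th _ do rewrite /= ger0_norm ?gap_mon_ge0 //.
by rewrite torus_moment_cyc ltry.
Qed.

Lemma Rintegral_gap_sum m (s : seq (multinom m)) (c : multinom m -> R) :
  (mu m).-integrable (@cyc R m) (EFin \o (fun th => \sum_(e <- s) c e * gap_mon e th))
  /\ (\int[mu m]_(th in @cyc R m) (\sum_(e <- s) c e * gap_mon e th))%R
     = \sum_(e <- s) c e * simplex_moment R (mnm_seq e).
Proof.
have mc := @measurable_cyc R m.
elim: s => [|e s [int_s IH]].
  split.
    rewrite (_ : EFin \o _ = cst 0%E); first exact: integrable0.
    by apply: funext => th /=; rewrite big_nil.
  under eq_Rintegral => th _ do rewrite big_nil.
  by rewrite big_nil /Rintegral integral0.
have -> : (fun th => \sum_(e0 <- e :: s) c e0 * gap_mon e0 th)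
    = (fun th => c e * gap_mon e th) \+ (fun th => \sum_(e0 <- s) c e0 * gap_mon e0 th).
  by apply: funext => th; rewrite big_cons.
have int_e : (mu m).-integrable (@cyc R m) (EFin \o (fun th => c e * gap_mon e th)).
  rewrite (_ : EFin \o _ = (fun th => (c e)%:E * (EFin \o gap_mon e) th)%E).
    by apply: integrableZl => //; apply: integrable_gap_mon.
  by apply: funext => th.
split.
  have -> : EFin \o ((fun th => c e * gap_mon e th) \+
        (fun th => \sum_(e0 <- s) c e0 * gap_mon e0 th))
      = (fun th => (EFin \o (fun th => c e * gap_mon e th)%R) th
        + (EFin \o (fun th => \sum_(e0 <- s) c e0 * gap_mon e0 th)%R) th)%E.
    by apply: funext.
  exact: integrableD.
rewrite RintegralD // IH RintegralZl //; last exact: integrable_gap_mon.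
by rewrite big_cons /Rintegral torus_moment_cyc.
Qed.

Lemma cintegral_gap_sum m (s : seq (multinom m)) (c : multinom m -> C) :
  cintegral (mu m) (@cyc R m) (fun th => \sum_(e <- s) c e * (gap_mon e th)%:C%C)
  = \sum_(e <- s) c e * (simplex_moment R (mnm_seq e))%:C%C.
Proof.
have ReE (x : multinom m -> R) :
    complex.Re (\sum_(e <- s) c e * (x e)%:C%C) = \sum_(e <- s) complex.Re (c e) * x e.
  elim: (s) => [|e s' IH]; rewrite ?big_nil // !big_cons -IH.
  by case: (c e) => a b /=; case: (\sum_(_ <- _) _) => a' b' /=; ring.
have ImE (x : multinom m -> R) :
    complex.Im (\sum_(e <- s) c e * (x e)%:C%C) = \sum_(e <- s) complex.Im (c e) * x e.
  elim: (s) => [|e s' IH]; rewrite ?big_nil // !big_cons -IH.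
  by case: (c e) => a b /=; case: (\sum_(_ <- _) _) => a' b' /=; ring.
rewrite /cintegral.
under eq_Rintegral => th _ do rewrite ReE.
under [X in (_ +i* X)%C]eq_Rintegral => th _ do rewrite ImE.
rewrite !(proj2 (Rintegral_gap_sum _ _)).
by apply/eqP; rewrite eq_complex /= ReE ImE !eqxx.
Qed.

Section Polynomial.
Variable r : nat.

Definition scal (x : R) : polAh R r := mpolyC (r + r) (polyC x%:C%C).

Lemma scal_zmod : zmod_morphism scal.
Proof. by move=> x y; rewrite /scal !rmorphB. Qed.
Lemma scal_monoid : monoid_morphism scal.
Proof. by split=> [|x y]; rewrite /scal ?rmorph1 ?rmorphM. Qed.

HB.instance Definition _ := GRing.isZmodMorphism.Build R (polAh R r) scal scal_zmod.
HB.instance Definition _ := GRing.isMonoidMorphism.Build R (polAh R r) scal scal_monoid.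

(** The integral over Cyc of a polynomial in the gaps. *)
Definition gap_int m (P : mpoly m (polAh R r)) : polAh R r := simplex_int scal P.

(** The coefficientwise integral is unique, and each coefficient of the integrand
    is a linear combination of monomials in the gaps, whose integrals are the
    moments of the simplex. *)
Lemma mpoly_integral_cyc m (P : mpoly m (polAh R r))
    (Phi : m.+1.-tuple mR -> polAh R r) :
  (forall th, cyc th -> Phi th = meval (fun i => scal (gap th i)) P) ->
  mpoly_integral (mu m) (@cyc R m) Phi = gap_int P.
Proof.
rewrite /gap_int => PhiE; suff hJ : is_mpoly_integral (mu m) (@cyc R m) Phi (simplex_int scal P).
  apply: (mpoly_integral_uniq _ hJ); rewrite /mpoly_integral.
  by case: xgetP => [I _ //|no]; exfalso; exact: (no _ hJ).
move=> a j.
have coefE (Q : polAh R r) x :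
    (mcoeff a (Q * scal x))`_j = (mcoeff a Q)`_j * x%:C%C.
  by rewrite mcoeffMC coefMC.
have coef_sumE (s : seq (multinom m)) (G : multinom m -> polAh R r) :
    (mcoeff a (\sum_(e <- s) G e))`_j = \sum_(e <- s) (mcoeff a (G e))`_j.
  elim: s => [|e s IH]; first by rewrite !big_nil mcoeff0 coef0.
  by rewrite !big_cons mcoeffD coefD IH.
transitivity (cintegral (mu m) (@cyc R m) (fun th =>
    \sum_(e <- msupp P) (mcoeff a (mcoeff e P))`_j * (gap_mon e th)%:C%C)).
  rewrite cintegral_gap_sum /simplex_int coef_sumE.
  by apply: eq_bigr => e _; rewrite coefE.
have scal_mon th (e : multinom m) : \prod_(i < m) scal (gap th i) ^+ e i = scal (gap_mon e th).
  by rewrite /gap_mon rmorph_prod; apply: eq_bigr => i _; rewrite rmorphXn.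
have valueE th : cyc th -> (mcoeff a (Phi th))`_j
    = \sum_(e <- msupp P) (mcoeff a (mcoeff e P))`_j * (gap_mon e th)%:C%C.
  move=> thc; rewrite PhiE // mevalE coef_sumE; apply: eq_bigr => e _.
  by rewrite scal_mon coefE.
by congr (_ +i* _)%C; apply: eq_Rintegral => th; rewrite inE => thc; rewrite valueE.
Qed.

Lemma gap_int_linear m : linear (@gap_int m : mpoly m (polAh R r) -> (polAh R r)^o).
Proof. exact: simplex_int_linear. Qed.

HB.instance Definition _ m :=
  GRing.isLinear.Build (polAh R r) (mpoly m (polAh R r)) (polAh R r)^o _
    (@gap_int m) (@gap_int_linear m).

Lemma gap_intZ m c (P : mpoly m (polAh R r)) : gap_int (c *: P) = c * gap_int P.
Proof. exact: simplex_intZ. Qed.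

Lemma gap_intD m (P Q : mpoly m (polAh R r)) : gap_int (P + Q) = gap_int P + gap_int Q.
Proof. exact: raddfD (@simplex_int _ _ scal m) P Q. Qed.

Lemma gap_intX m (e : multinom m) :
  gap_int (mpolyX _ e) = scal (simplex_moment R (mnm_seq e)).
Proof. exact: simplex_intX. Qed.

Lemma gap_int_stokes m (l : 'I_m.+1) (P : mpoly m.+1 (polAh R r)) :
  gap_int (mderiv l P) = gap_int (face l (upper_neighbour _ l) P)
                         - gap_int (face l (lower_neighbour _ l) P).
Proof. exact: simplex_stokes. Qed.

End Polynomial.
End CyclicIntegral.

(** * Exponentials of a polynomial family of operators *)
Section PolynomialFamily.
Variables (K : comNzRingType) (V : Type) (m : nat).
Variables (D : V -> K) (B : V -> V) (A : 'I_m -> V -> V).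

(** The polynomial D ((B + sum_i u_i A_i)^j F) in u. *)
Fixpoint power_poly j (F : V) : mpoly m K :=
  if j is j'.+1 then
    power_poly j' (B F) + \sum_(i < m) mpolyX K (mnm1 i) * power_poly j' (A i F)
  else mpolyC m (D F).

Lemma meval_power_poly (u : 'I_m -> K) (L : V -> V) j F :
  (forall j F, D (iter j L (L F))
     = D (iter j L (B F)) + \sum_(i < m) u i * D (iter j L (A i F))) ->
  meval u (power_poly j F) = D (iter j L F).
Proof.
move=> LE; elim: j F => [|j IH] F; first by rewrite /= mevalC.
rewrite iterSr LE /= mevalD IH raddf_sum; congr (_ + _); apply: eq_bigr => i _ /=.
by rewrite mevalM mevalXU IH.
Qed.

Hypothesis AB : forall i F, A i (B F) = B (A i F).
Hypothesis AA : forall i j F, A i (A j F) = A j (A i F).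

(** As the operators commute, the derivative of (B + sum_i u_i A_i)^j in the
    direction u_l is j (B + sum_i u_i A_i)^(j - 1) A_l. *)
Lemma mderiv_power_poly l j F :
  mderiv l (power_poly j F) = j%:R *: power_poly j.-1 (A l F).
Proof.
elim: j F => [|j IH] F; first by rewrite /= mderivC scale0r.
have term i : mderiv l (mpolyX K (mnm1 i) * power_poly j (A i F))
    = (i == l)%:R * power_poly j (A i F)
      + j%:R *: (mpolyX K (mnm1 i) * power_poly j.-1 (A i (A l F))).
  by rewrite mderivM mderivXU IH AA scalerAr.
have -> : mderiv l (power_poly j.+1 F)
    = mderiv l (power_poly j (B F))
      + \sum_(i < m) mderiv l (mpolyX K (mnm1 i) * power_poly j (A i F)).
  by rewrite /= mderivD raddf_sum.
under eq_bigr => i _ do rewrite term.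
rewrite big_split /= (bigD1 l) //= eqxx mul1r big1 ?addr0; last first.
  by move=> i /negbTE ->; rewrite mul0r.
rewrite IH AB -scaler_sumr addrCA -scalerDr -[in RHS]natr1 scalerDl scale1r addrC.
by case: j {IH term} => [|j] //=; rewrite !scale0r.
Qed.

Variable c : nat -> K.
Hypothesis cS : forall j, j.+1%:R * c j.+1 = c j.

Local Arguments power_poly : simpl never.

(** With c j = 1 / j!, this is the truncation of D (exp (B + sum_i u_i A_i) F). *)
Definition exp_poly N F : mpoly m K := \sum_(j < N) c j *: power_poly j F.

Lemma mderiv_exp_poly l N F : mderiv l (exp_poly N.+1 F) = exp_poly N (A l F).
Proof.
rewrite /exp_poly big_ord_recl mderivD mderivZ mderiv_power_poly scale0r scaler0 add0r.
rewrite raddf_sum /=; apply: eq_bigr => j _; rewrite /bump add1n.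
by rewrite mderivZ mderiv_power_poly scalerA mulrC cS.
Qed.

End PolynomialFamily.

(** * The Stokes formula for chains *)
Section CyclicChainIntegral.
Variables (R : realType) (r : nat).
Local Notation C := R[i].
Local Notation mR := (measurableTypeR R).

Lemma bidiffZ m c (g : 'I_m.+1 -> 'I_m.+1 -> C) (F : chain R r m) :
  bidiff (fun k l => c * g k l) F = polyC c *: bidiff g F.
Proof.
rewrite /bidiff scalerA [_ * ihbar R]mulrC -scalerA; congr (_ *: _).
rewrite scaler_sumr; apply: eq_bigr => k _; rewrite scaler_sumr.
apply: eq_bigr => l _; rewrite scaler_sumr; apply: eq_bigr => i _.
by rewrite polyCM scalerA.
Qed.

Lemma bidiff_sum m n (c : 'I_n -> C) g0 (g : 'I_n -> 'I_m.+1 -> 'I_m.+1 -> C)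
    (F : chain R r m) :
  bidiff (fun k l => g0 k l + \sum_(i < n) c i * g i k l) F
  = bidiff g0 F + \sum_(i < n) polyC (c i) *: bidiff (g i) F.
Proof.
rewrite (@bidiffD _ _ _ _ g0 (fun k l => \sum_(i < n) c i * g i k l)) //.
congr (_ + _); elim: n c g => [|n IH] c g.
  rewrite big_ord0 (@eq_bidiff _ _ _ _ (fun k l => 0 * 0)); last first.
    by move=> k l; rewrite big_ord0 mul0r.
  by rewrite (bidiffZ 0) scale0r.
rewrite big_ord_recl -IH -bidiffZ; apply: bidiffD => k l.
by rewrite big_ord_recl.
Qed.

(** The affine function of the gaps which is Green's function on Cyc. It is
    defined for all u, and on the faces of the simplex it gives the one-sided
    limits of Green's function rather than its values. *)
Definition gap_green m (u : 'I_m -> R) (k l : 'I_m.+1) : C :=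
  (orient R k l + level u l - level u k)%:C%C.

Definition base_op m : chain R r m -> chain R r m :=
  bidiff (fun k l => (orient R k l + (l == ord0)%:R - (k == ord0)%:R)%:C%C).

(** The derivative of the exponent with respect to the level of the slot k0. *)
Definition slot_op m (k0 : 'I_m.+1) : chain R r m -> chain R r m :=
  bidiff (fun k l => ((l == k0)%:R - (k == k0)%:R : R)%:C%C).

Definition gap_op m (i : 'I_m) : chain R r m -> chain R r m := slot_op (lift ord0 i).

Lemma levelE m (u : 'I_m -> R) k :
  level u k = (k == ord0)%:R + \sum_(i < m) u i * (k == lift ord0 i)%:R.
Proof.
case: (unliftP ord0 k) => [j|] ->.
  rewrite level_lift eq_sym (negbTE (neq_lift _ _)) add0r (bigD1 j) //= eqxx mulr1.
  rewrite big1 ?addr0 // => i /negbTE ij.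
  by rewrite (inj_eq lift_inj) eq_sym ij mulr0.
rewrite level0 eqxx big1 ?addr0 // => i _.
by rewrite (negbTE (neq_lift _ _)) mulr0.
Qed.

Lemma bidiff_gap_green m (u : 'I_m -> R) F :
  bidiff (gap_green u) F
  = base_op F + \sum_(i < m) (u i)%:C%C%:P *: gap_op i F.
Proof.
rewrite -bidiff_sum; congr (bidiff _ F); apply: funext => k; apply: funext => l.
transitivity ((orient R k l + (l == ord0)%:R - (k == ord0)%:R
    + \sum_(i < m) u i * ((l == lift ord0 i)%:R - (k == lift ord0 i)%:R))%:C)%C.
  rewrite /gap_green (levelE u k) (levelE u l); congr (_%:C)%C.
  by under [in RHS]eq_bigr => i _ do rewrite mulrBr; rewrite sumrB; ring.
rewrite rmorphD rmorph_sum; congr (_ + _).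
by apply: eq_bigr => i _; rewrite rmorphM.
Qed.

(** The action of sigma on the coefficients of a form, once the derivatives in
    the slots 1, ..., m have been taken. *)
Definition slots_int m (F : chain R r m) : polAh R r :=
  mpoly_integral (torus_measure R m.+1) (@cyc R m)
    (fun th => diagonal (exp_op (green_op th) F)).

Lemma green_op_gap m (th : m.+1.-tuple mR) :
  cyc th -> @green_op R r m th = bidiff (gap_green (gap th)).
Proof.
move=> thc; rewrite -[LHS]/(bidiff (fun k l => (green (tnth th k) (tnth th l))%:C%C)).
by apply: eq_bidiff => k l; rewrite green_cyc.
Qed.

Lemma scalE (x : R) (Q : polAh R r) : scal r x * Q = (x%:C%C)%:P *: Q.
Proof. exact: mul_mpolyC. Qed.

Lemma diagonal_linear m : linear (@diagonal (Ch R) (r + r) m).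
Proof. by move=> c F G; rewrite !diagonalE linearP. Qed.

Lemma exp_bidiff_sum m (g : 'I_m.+1 -> 'I_m.+1 -> C) n (G : 'I_n -> chain R r m) :
  exp_op (bidiff g) (\sum_(i < n) G i) = \sum_(i < n) exp_op (bidiff g) (G i).
Proof.
have expL : linear (exp_op (@bidiff R r m g)).
  by apply: exp_op_linear; apply: bidiff_lowers.
pose E := HB.pack_for {linear chain R r m -> chain R r m} (exp_op (@bidiff R r m g))
  (GRing.isLinear.Build _ _ _ _ (exp_op (@bidiff R r m g)) expL).
exact: (linear_sum E).
Qed.

HB.instance Definition _ m :=
  GRing.isLinear.Build (Ch R) (chain R r m) (polAh R r) _
    (@diagonal (Ch R) (r + r) m) (@diagonal_linear m).

Definition exp_coef j : polAh R r := mpolyC _ (inv_fact R j).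

Lemma exp_coefS j : j.+1%:R * exp_coef j.+1 = exp_coef j.
Proof. by rewrite /exp_coef -mpolyC_nat -mpolyCM inv_factS. Qed.

(** The integrand of [slots_int F] as a polynomial in the gaps, if N exceeds the
    degree of F. *)
Definition chain_poly m N (F : chain R r m) : mpoly m (polAh R r) :=
  exp_poly (@diagonal (Ch R) (r + r) m) (@base_op m) (@gap_op m) exp_coef N F.

Lemma meval_chain_poly m N (F : chain R r m) (u : 'I_m -> R) :
  (mmeasure mdeg F <= N)%N ->
  meval (fun i => scal r (u i)) (chain_poly N F)
  = diagonal (exp_op (bidiff (gap_green u)) F).
Proof.
move=> FN.
have low := @bidiff_lowers R r m (gap_green u).
have expE : exp_op (bidiff (gap_green u)) F = exp_trunc N (bidiff (gap_green u)) F.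
  exact: exp_opE low FN.
rewrite expE.
pose diag : {linear chain R r m -> polAh R r} := @diagonal (Ch R) (r + r) m.
apply: etrans (raddf_sum (meval _) _ _ _) _.
apply: etrans (esym (linear_sum diag _ _ _)); apply: eq_bigr => j _.
apply: etrans (mevalZ _ _ _) _; apply: etrans (esym (linearZ_LR diag _ _)).
apply: etrans (mul_mpolyC _ _); congr (_ * _).
apply: meval_power_poly => k G.
rewrite bidiff_gap_green; set L := bidiff _.
pose iter_diag (H : chain R r m) : polAh R r := diagonal (iter k L H).
have iterL : linear iter_diag.
  by move=> c G1 G2; rewrite /iter_diag iter_linear diagonal_linear.
pose T := HB.pack_for {linear chain R r m -> polAh R r} iter_diag
  (GRing.isLinear.Build _ _ _ _ iter_diag iterL).
apply: etrans (linearD T _ _) _; congr (_ + _).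
apply: etrans (linear_sum T _ _ _) _; apply: eq_bigr => i _.
by apply: etrans (linearZ_LR T _ _) _; rewrite scalE.
Qed.

Lemma slots_intE m (F : chain R r m) (P : mpoly m (polAh R r)) :
  (forall u : 'I_m -> R, meval (fun i => scal r (u i)) P
     = diagonal (exp_op (bidiff (gap_green u)) F)) ->
  slots_int F = gap_int P.
Proof.
move=> PE; have valueE (th : m.+1.-tuple mR) : cyc th ->
    diagonal (exp_op (green_op th) F) = meval (fun i => scal r (gap th i)) P.
  by move=> thc; rewrite (green_op_gap thc) PE.
exact: (mpoly_integral_cyc valueE).
Qed.

Lemma slots_int_chain_poly m (F : chain R r m) N : (mmeasure mdeg F <= N)%N ->
  slots_int F = gap_int (chain_poly N F).
Proof. by move=> FN; apply: slots_intE => u; apply: meval_chain_poly. Qed.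

Lemma slots_int_linear m : linear (@slots_int m).
Proof.
move=> c F G.
rewrite (slots_int_chain_poly (leqnn (mmeasure mdeg F))).
rewrite (slots_int_chain_poly (leqnn (mmeasure mdeg G))).
rewrite -[in RHS]mul_mpolyC -gap_intZ -gap_intD.
apply: slots_intE => u; rewrite mevalD mevalZ !meval_chain_poly //.
rewrite mul_mpolyC -diagonal_linear; congr diagonal.
by rewrite exp_op_linear //; apply: bidiff_lowers.
Qed.

HB.instance Definition _ m :=
  GRing.isLinear.Build (Ch R) (chain R r m) (polAh R r) _
    (@slots_int m) (@slots_int_linear m).

Lemma mderiv_scal v (Q : polAh R r) x : mderiv v (Q * scal r x) = mderiv v Q * scal r x.
Proof. by rewrite mderivM mderivC mulr0 addr0. Qed.

(** The derivative commutes with the integral, becomes a sum over all slots on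
    the diagonal, and commutes with the exponential. *)
Lemma mderiv_slots_int m v (F : chain R r m) :
  mderiv v (slots_int F) = slots_int (\sum_(k < m.+1) mderiv (slot_var k v) F).
Proof.
have FE := slots_int_chain_poly (leqnn (mmeasure mdeg F)); rewrite FE.
set P := chain_poly _ _.
pose dP := \sum_(e <- msupp P) mderiv v (mcoeff e P) *: mpolyX (polAh R r) e.
transitivity (gap_int dP).
  apply: etrans (raddf_sum (mderiv v) _ _ _) _.
  apply: etrans (esym (linear_sum (@gap_int R r m) _ _ _)); apply: eq_bigr => e _ /=.
  by rewrite mderiv_scal gap_intZ gap_intX.
apply/esym; apply: slots_intE => u.
have scal_mon (e : multinom m) :
    \prod_(i < m) scal r (u i) ^+ e i = scal r (\prod_(i < m) u i ^+ e i).
  by rewrite rmorph_prod; apply: eq_bigr => i _; rewrite rmorphXn.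
transitivity (mderiv v (meval (fun i => scal r (u i)) P)).
  apply: etrans (raddf_sum (meval _) _ _ _) _; apply: esym.
  apply: etrans (congr1 _ (mevalE _ _)) _; apply: etrans (raddf_sum (mderiv v) _ _ _) _.
  by apply: eq_bigr => e _ /=; rewrite mevalZ mevalX scal_mon mderiv_scal.
rewrite meval_chain_poly // mderiv_diagonal.
rewrite exp_bidiff_sum (linear_sum (@diagonal (Ch R) (r + r) m)).
by apply: eq_bigr => k _; rewrite exp_bidiff_mderiv.
Qed.

Lemma base_gap_comm m i (F : chain R r m) : gap_op i (base_op F) = base_op (gap_op i F).
Proof. exact: bidiff_comm. Qed.

Lemma gap_gap_comm m i j (F : chain R r m) : gap_op i (gap_op j F) = gap_op j (gap_op i F).
Proof. exact: bidiff_comm. Qed.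

(** a_0, ..., a_k * a_(k+1), ..., a_(m+1) *)
Definition merge_slot m (k : 'I_m.+1) : chain R r m.+1 -> chain R r m :=
  merge (collapse (lift ord0 k) k) (lift (lift ord0 k) k) (lift ord0 k).

(** a_(m+1) * a_0, a_1, ..., a_m *)
Definition merge_wrap m : chain R r m.+1 -> chain R r m :=
  merge (collapse ord_max ord0) ord_max ord0.

(** A point of the hyperplane u_l = v. *)
Definition repeat_gap m (u : 'I_m -> R) (l : 'I_m.+1) (v : R) (i : 'I_m.+1) : R :=
  oapp u v (unlift l i).

(** On a face of the simplex two points collide. The face is again a simplex, on
    which the integrand is that of the chain M F with the two slots multiplied. *)
Lemma slots_int_face m (F : chain R r m.+1) (l : 'I_m.+1) (w : mpoly m (polAh R r))
    (v : ('I_m -> R) -> R) (M : chain R r m.+1 -> chain R r m) N :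
  (mmeasure mdeg F <= N)%N ->
  (forall u, meval (fun i => scal r (u i)) w = scal r (v u)) ->
  (forall u, diagonal (exp_op (bidiff (gap_green (repeat_gap u l (v u)))) F)
             = diagonal (exp_op (bidiff (gap_green u)) (M F))) ->
  gap_int (face l w (chain_poly N F)) = slots_int (M F).
Proof.
move=> FN wE mergeE; apply: esym; apply: slots_intE => u.
rewrite -mergeE -(meval_chain_poly _ FN) meval_face; apply: meval_eq => i.
by rewrite /repeat_gap wE; case: unlift.
Qed.

Lemma lift_lift0 m (l : 'I_m.+1) (i : 'I_m) :
  lift (lift ord0 l) (lift ord0 i) = lift ord0 (lift l i).
Proof. by apply: val_inj; rewrite /= /bump /= !add1n ltnS addnS. Qed.

Lemma lift_max0 m (j : 'I_m) :
  lift ord_max (lift ord0 j) = lift ord0 (lift ord_max j) :> 'I_m.+2.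
Proof. by apply: ord_inj; rewrite lift_max !lift0 lift_max. Qed.

Lemma lift_max_self m (j : 'I_m) : lift (lift ord_max j) j = lift ord0 j :> 'I_m.+1.
Proof. by apply: ord_inj; rewrite -[LHS]/(bump (lift ord_max j) j) lift_max /bump leqnn. Qed.

Lemma lift0_self m (j : 'I_m) : lift (lift ord0 j) j = lift ord_max j :> 'I_m.+1.
Proof.
by apply: ord_inj; rewrite lift_max -[LHS]/(bump (lift ord0 j) j) lift0 /bump ltnn.
Qed.

Lemma lift_max_lift0 m (j i : 'I_m) :
  i != j -> lift (lift ord_max j) i = lift (lift ord0 j) i.
Proof.
move=> ij; apply: ord_inj; have {}ij : i != j :> nat by [].
have := ltn_ord j; rewrite -[LHS]/(bump (lift ord_max j) i) lift_max.
rewrite -[RHS]/(bump (lift ord0 j) i) lift0 /bump => jm.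
by case: (leqP j i) => h1; case: (leqP j.+1 i) => h2; lia.
Qed.

Lemma level_repeat m (u : 'I_m -> R) (l : 'I_m.+1) k :
  level (repeat_gap u l (level u l)) k = level u (collapse (lift ord0 l) l k).
Proof.
case: (unliftP (lift ord0 l) k) => [j|] ->; last first.
  by rewrite collapse_removed level_lift /repeat_gap unlift_none.
rewrite collapse_lift; case: (unliftP ord0 j) => [i|] ->.
  by rewrite lift_lift0 !level_lift /repeat_gap liftK.
have -> : lift (lift ord0 l) ord0 = ord0 :> 'I_m.+2 by apply: val_inj.
by rewrite !level0.
Qed.

Lemma moyal_kernelE m (p q k l : 'I_m.+1) :
  moyal_kernel R p q k l = (2^-1 * ((k == p) && (l == q))%:R
                    - 2^-1 * ((k == q) && (l == p))%:R : R)%:C%C.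
Proof. by rewrite /moyal_kernel rmorphB !rmorphM /= fmorphV !rmorph_nat. Qed.

Lemma val_collapse m (l : 'I_m.+1) (k : 'I_m.+2) :
  collapse (lift ord0 l) l k = (if (k <= l)%N then k : nat else k.-1) :> nat.
Proof.
case: (unliftP (lift ord0 l) k) => [/= j|] ->.
  rewrite collapse_lift /= /bump /= add1n.
  by have [lj|lj] := leqP l.+1 j; rewrite /= ?add1n ?add0n; case: leqP => h; lia.
by rewrite collapse_removed /= /bump /= add1n ltnn.
Qed.

Lemma orient_collapse m (l : 'I_m.+1) (k k' : 'I_m.+2) :
  orient R k k'
  = orient R (collapse (lift ord0 l) l k) (collapse (lift ord0 l) l k')
    + (2^-1 * ((k == lift (lift ord0 l) l) && (k' == lift ord0 l))%:R
       - 2^-1 * ((k == lift ord0 l) && (k' == lift (lift ord0 l) l))%:R).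
Proof.
rewrite /orient !val_collapse -!(inj_eq val_inj) /=.
have -> : bump (bump 0 l) l = l by rewrite /bump /= add1n ltnn.
have -> : bump 0 l = l.+1 by rewrite /bump add1n.
move: (k : nat) (k' : nat) (l : nat) => {k k' l} a b c.
have ltE x y : ((if x <= c then x else x.-1) < (if y <= c then y else y.-1))%N
    = (x < y)%N && ~~ ((x == c) && (y == c.+1)).
  by case: (leqP x c) => xc; case: (leqP y c) => yc; lia.
rewrite !ltE [(b == c) && _]andbC.
case: (ltngtP a b) => [ab|ba|<-] /=.
- have -> : (a == c.+1) && (b == c) = false by lia.
  by case: (_ && _) => /=; lra.
- have -> : (a == c) && (b == c.+1) = false by lia.
  by case: (_ && _) => /=; lra.
- have -> : (a == c) && (a == c.+1) = false by lia.
  have -> : (a == c.+1) && (a == c) = false by lia.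
  by lra.
Qed.

(** The points l and l + 1 collide. Since their levels agree, what is left of
    Green's function between them is orient, that is, the Moyal kernel. *)
Lemma gap_green_repeat m (u : 'I_m -> R) (l : 'I_m.+1) (k k' : 'I_m.+2) :
  gap_green (repeat_gap u l (level u l)) k k'
  = gap_green u (collapse (lift ord0 l) l k) (collapse (lift ord0 l) l k')
    + moyal_kernel R (lift (lift ord0 l) l) (lift ord0 l) k k'.
Proof.
rewrite moyal_kernelE /gap_green !level_repeat -rmorphD; congr (_%:C)%C.
by rewrite (orient_collapse l); lra.
Qed.

Lemma val_collapse_wrap m (k : 'I_m.+2) :
  collapse ord_max ord0 k = (if k == m.+1 :> nat then 0 else k : nat)%N :> nat.
Proof.
case: (unliftP ord_max k) => [/= j|] ->.
  by rewrite collapse_lift lift_max ltn_eqF.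
by rewrite collapse_removed /= eqxx.
Qed.

Lemma level_wrap m (u : 'I_m -> R) (k : 'I_m.+2) :
  level (repeat_gap u ord_max 0) k
  = level u (collapse ord_max ord0 k) - (k == m.+1 :> nat)%:R.
Proof.
case: (unliftP ord_max k) => [/= j|] ->; last first.
  rewrite collapse_removed level0 eqxx subrr.
  have -> : ord_max = lift ord0 ord_max :> 'I_m.+2 by apply: val_inj.
  by rewrite level_lift /repeat_gap unlift_none.
rewrite collapse_lift lift_max ltn_eqF // subr0.
case: (unliftP ord0 j) => [i|] ->.
  have -> : lift ord_max (lift ord0 i) = lift ord0 (lift ord_max i) :> 'I_m.+2.
    by apply: ord_inj; rewrite lift_max !lift0 lift_max.
  by rewrite !level_lift /repeat_gap liftK.
have -> : lift ord_max ord0 = ord0 :> 'I_m.+2 by apply: val_inj.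
by rewrite !level0.
Qed.

(** The last point reaches theta_0 after a full turn. Its level is then 0, that
    of theta_0 is 1, and the difference turns the value 1/2 of orient at
    (0, m + 1) into -1/2: the last slot is the left factor. *)
Lemma gap_green_wrap m (u : 'I_m -> R) (k k' : 'I_m.+2) :
  gap_green (repeat_gap u ord_max 0) k k'
  = gap_green u (collapse ord_max ord0 k) (collapse ord_max ord0 k')
    + moyal_kernel R ord_max ord0 k k'.
Proof.
rewrite moyal_kernelE /gap_green !level_wrap -rmorphD; congr (_%:C)%C.
have orientE : orient R k k' + (k == m.+1 :> nat)%:R - (k' == m.+1 :> nat)%:R
    = orient R (collapse ord_max ord0 k) (collapse ord_max ord0 k')
      + (2^-1 * ((k == ord_max) && (k' == ord0))%:R
         - 2^-1 * ((k == ord0) && (k' == ord_max))%:R).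
  rewrite /orient !val_collapse_wrap -!(inj_eq val_inj) /=.
  move: (leq_ord k) (leq_ord k').
  move: (k : nat) (k' : nat) => {k k'} a b.
  case: (eqVneq a m.+1) => am; case: (eqVneq b m.+1) => bm;
  case: (eqVneq a 0%N) => a0; case: (eqVneq b 0%N) => b0 al bl;
  case: (ltngtP a b) => ab; try lia; rewrite ?ltnn ?lt0n ?a0 ?b0 /=; try lra.
by move: orientE; lra.
Qed.

(** At the lower face of u_l, the point l + 1 collides with the next one, which
    is theta_0 for the last point. *)
Definition next_merge m (l : 'I_m.+1) : chain R r m.+1 -> chain R r m :=
  if unlift ord_max l is Some j then merge_slot (lift ord0 j) else @merge_wrap m.

(** The exponent has the derivative gap_op l in the direction u_l, so the
    integrand on the left is a derivative. At the two faces the point l + 1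
    collides with its two neighbours. *)
Lemma slots_int_stokes m (l : 'I_m.+1) (F : chain R r m.+1) :
  slots_int (gap_op l F) = slots_int (merge_slot l F) - slots_int (next_merge l F).
Proof.
pose N := maxn (mmeasure mdeg F) (mmeasure mdeg (gap_op l F)).
have FN : (mmeasure mdeg F <= N.+1)%N by rewrite leqW // leq_maxl.
rewrite (@slots_int_chain_poly _ _ N) ?leq_maxr //.
have <- : mderiv l (chain_poly N.+1 F) = chain_poly N (gap_op l F).
  exact: (mderiv_exp_poly _ (@base_gap_comm _) (@gap_gap_comm _) exp_coefS).
rewrite gap_int_stokes; congr (_ - _).
  apply: (slots_int_face (v := fun u => level u l) FN) => u.
    rewrite /upper_neighbour /level; case: unliftP => [j|] _ /=.
      exact: mevalXU.
    by rewrite meval1 rmorph1.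
  by apply: diagonal_exp_merge => k k'; apply: gap_green_repeat.
rewrite /next_merge /lower_neighbour; case: unliftP => [j|] lE /=.
  apply: (slots_int_face (v := fun u => u j) FN) => u; first exact: mevalXU.
  (* Repeating a gap on its left or on its right gives the same point: the lower
     face of u_l is the upper face of the next gap. *)
  have -> : repeat_gap u l (u j) = repeat_gap u (lift ord0 j) (level u (lift ord0 j)).
    rewrite lE level_lift; apply: funext => i; rewrite /repeat_gap.
    case: (unliftP (lift ord_max j) i) => [i' ->|->] /=.
      have [->|ij] := eqVneq i' j; last by rewrite lift_max_lift0 // liftK.
      by rewrite lift_max_self unlift_none.
    by rewrite -lift0_self liftK.
  by apply: diagonal_exp_merge => k k'; apply: gap_green_repeat.
apply: (slots_int_face (v := fun u => 0) FN) => u; first by rewrite meval0 rmorph0.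
by rewrite lE; apply: diagonal_exp_merge => k k'; apply: gap_green_wrap.
Qed.

End CyclicChainIntegral.

(** * Wedge products of one-forms *)
Section WedgeCoefficients.
Variable n : nat.
Implicit Types (S : {set 'I_n}) (s : seq 'I_n) (u v : 'I_n).

Definition count_below v S : nat := #|[set x in S | (x < v)%N]|.

(** The coefficient of dy_S in dy_s1 /\ ... /\ dy_sq. *)
Fixpoint wedge_coef s S : int :=
  if s is v :: s' then
    if v \in S then (-1) ^+ count_below v S * wedge_coef s' (S :\ v) else 0
  else (S == finset.set0)%:R.

Lemma count_below_add u v S : v \notin S ->
  count_below u (v |: S) = (count_below u S + (v < u))%N.
Proof.
move=> vS; rewrite /count_below addnC; have [vu|uv] := boolP (v < u)%N.
  rewrite (_ : [set x in v |: S | (x < u)%N] = v |: [set x in S | (x < u)%N]).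
    by rewrite cardsU1 !inE (negbTE vS).
  by apply/finset.setP => x; rewrite !inE; case: eqVneq => // ->; rewrite vu.
rewrite add0n; apply: eq_card => x; rewrite !inE.
by case: eqVneq => // ->; rewrite (negbTE uv) (negbTE vS).
Qed.

Lemma count_below_rem u v S : v \in S ->
  count_below u S = (count_below u (S :\ v) + (v < u))%N.
Proof.
by move=> vS; rewrite -{1}(finset.setD1K vS) count_below_add // !inE eqxx.
Qed.

Definition remove_at (l : nat) s := take l s ++ drop l.+1 s.

(** The contraction with d/dy_v is an antiderivation: it removes the factors dy_v
    one at a time, with alternating signs. By induction on the number of factors;
    the sign for moving v past the first factor u comes from the order of u and
    v, which enters the two counts in opposite ways. *)
Lemma contraction_wedge_coef s v S (v0 : 'I_n) :
  (if v \in S then 0 else (-1) ^+ count_below v S * wedge_coef s (v |: S))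
  = \sum_(l < size s) (nth v0 s l == v)%:R * ((-1) ^+ l * wedge_coef (remove_at l s) S).
Proof.
elim: s S => [|u s IH] S /=.
  rewrite big_ord0; case: ifP => // _.
  have -> : (v |: S == finset.set0) = false.
    by apply/negbTE/finset.set0Pn; exists v; rewrite finset.setU11.
  by rewrite mulr0.
rewrite big_ord_recl /= expr0 mul1r /remove_at /= drop0.
under eq_bigr => l _ do rewrite /bump /= add1n /= exprS mulN1r.
rewrite -/(remove_at _ _).
have -> : \sum_(l < size s) (nth v0 s l == v)%:R
      * (- (-1) ^+ l * wedge_coef (u :: remove_at l s) S)
    = (if u \in S then - ((-1) ^+ count_below u S
        * \sum_(l < size s) (nth v0 s l == v)%:R
            * ((-1) ^+ l * wedge_coef (remove_at l s) (S :\ u)))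
       else 0) :> int.
  case: ifP => uS; last by rewrite big1 // => l _; rewrite /= uS !mulr0.
  by rewrite mulr_sumr -sumrN; apply: eq_bigr => l _; rewrite /= uS; ring.
rewrite -IH !inE; have [uv|uv] := eqVneq u v.
  rewrite -uv /= mul1r; case: (boolP (u \in S)) => uS.
    rewrite finset.setD1K // (count_below_rem u uS) ltnn addn0.
    by rewrite mulrA -expr2 sqrr_sign mul1r addrN.
  rewrite addr0 count_below_add // ltnn addn0 finset.setU1K //.
  by rewrite mulrA -expr2 sqrr_sign mul1r.
rewrite mul0r add0r /=.
case: (boolP (v \in S)) => vS; first by case: ifP => //; rewrite ?mulr0 ?oppr0.
case: (boolP (u \in S)) => uS; last by rewrite mulr0.
have -> : (v |: S) :\ u = v |: (S :\ u).
  apply/finset.setP => x; rewrite !inE; case: (eqVneq x v) => [->|] //=.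
  by rewrite eq_sym uv.
rewrite count_below_add // (count_below_rem v uS) !exprD.
have vuE : (-1) ^+ (v < u)%N = - (-1) ^+ (u < v)%N :> int.
  have [h|h|/val_inj h] := ltngtP v u; rewrite /= ?expr0 ?expr1 ?opprK //.
  by rewrite h eqxx in uv.
rewrite vuE; set x := (-1) ^+ (u < v)%N.
have xx : x * x = 1 by rewrite /x -expr2 sqrr_sign.
set a := (-1) ^+ _; set b := (-1) ^+ _; set w := wedge_coef _ _.
transitivity (- (b * (a * w)) * (x * x)); first by ring.
by rewrite xx mulr1.
Qed.

End WedgeCoefficients.

Section Insertion.
Variable T : finType.

Definition insert m (l : 'I_m.+1) (v : T) (s : {ffun 'I_m -> T}) : {ffun 'I_m.+1 -> T} :=
  [ffun i => oapp s v (unlift l i)].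

Lemma insert_at m (l : 'I_m.+1) v s : insert l v s l = v.
Proof. by rewrite ffunE unlift_none. Qed.

Lemma insert_lift m (l : 'I_m.+1) v s k : insert l v s (lift l k) = s k.
Proof. by rewrite ffunE liftK. Qed.

Lemma big_insert (V : nmodType) m (l : 'I_m.+1) (G : {ffun 'I_m.+1 -> T} -> V) :
  \sum_s G s = \sum_v \sum_s G (insert l v s).
Proof.
rewrite (reindex (fun p : T * {ffun 'I_m -> T} => insert l p.1 p.2)) /=.
  by rewrite -(pair_bigA _ (fun v s => G (insert l v s))).
exists (fun s : {ffun 'I_m.+1 -> T} => (s l, [ffun k => s (lift l k)])) => [[v s] _|s _].
  rewrite insert_at; congr (_, _); apply/ffunP => k.
  by rewrite ffunE insert_lift.
apply/ffunP => i; rewrite /= ffunE; case: unliftP => [k|] -> //=.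
by rewrite ffunE.
Qed.

Definition values m (s : {ffun 'I_m -> T}) : seq T := [seq s k | k <- enum 'I_m].

Lemma size_values m (s : {ffun 'I_m -> T}) : size (values s) = m.
Proof. by rewrite size_map size_enum_ord. Qed.

Lemma nth_values m v0 (s : {ffun 'I_m -> T}) (k : 'I_m) : nth v0 (values s) k = s k.
Proof. by rewrite (nth_map k) ?size_enum_ord // nth_ord_enum. Qed.

Lemma values_insert0 m v (s : {ffun 'I_m -> T}) :
  values (insert ord0 v s) = v :: values s.
Proof.
rewrite /values enum_ordSl /= insert_at -map_comp; congr (_ :: _).
by apply: eq_map => k /=; rewrite insert_lift.
Qed.

End Insertion.

Lemma remove_at_insert n m (l : 'I_m.+1) v (s : {ffun 'I_m -> 'I_n}) :
  remove_at l (values (insert l v s)) = values s.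
Proof.
have sz : size (remove_at l (values (insert l v s))) = m.
  rewrite size_cat size_takel ?size_values ?size_drop ?size_values ?(ltnW (ltn_ord l)) //.
  by have := leq_ord l; lia.
apply: (@eq_from_nth _ v); first by rewrite sz size_values.
rewrite sz => i im; rewrite -[ i ]/(nat_of_ord (Ordinal im)) nth_values.
rewrite -(insert_lift l v) -(nth_values v) /remove_at nth_cat.
rewrite size_takel ?size_values ?(ltnW (ltn_ord l)) //= /bump.
case: (ltnP i l) => il; first by rewrite nth_take.
by rewrite nth_drop; congr nth; lia.
Qed.

Section WedgeExpansion.
Variables (B : comNzRingType) (n : nat).

Lemma pair_inj (v : 'I_n) : injective (pair v : 'I_n -> 'I_n * 'I_n).
Proof. by move=> x y []. Qed.

Lemma wedge_sign1 v (S : {set 'I_n}) : v \in S ->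
  wedge_sign B [set v] (S :\: [set v]) = (-1) ^+ count_below v S.
Proof.
move=> vS; rewrite /wedge_sign /count_below; congr (_ ^+ _).
rewrite -[RHS](card_imset _ (@pair_inj v)); apply: eq_card => -[a b]; rewrite !inE /=.
apply/idP/imsetP => [/and3P[/eqP -> /andP[bv bS] ba]|[x]].
  by exists b => //; rewrite !inE bS ba.
rewrite !inE => /andP[xS xv] [-> ->]; rewrite eqxx xS xv !andbT /=.
by rewrite neq_ltn xv.
Qed.

Lemma wedge_one_form (c : 'I_n -> B) (w : form B n) (S : {set 'I_n}) :
  wedge (one_form c) w S
  = \sum_(v in S) (-1) ^+ count_below v S * (c v * w (S :\ v)).
Proof.
rewrite ffunE.
under eq_bigr => U _ do rewrite ffunE mulr_suml mulr_sumr big_mkcond.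
rewrite exchange_big [RHS]big_mkcond; apply: eq_bigr => v _ /=.
rewrite -big_mkcondr /=; case: ifP => vS.
  rewrite (big_pred1 [set v]) => [|U].
    by rewrite wedge_sign1.
  rewrite /= andbC; have [->|_] := eqVneq U [set v]; last by [].
  by rewrite finset.sub1set vS.
rewrite big_pred0 // => U; rewrite andbC; have [->|_] := eqVneq U [set v]; last by [].
by rewrite finset.sub1set vS.
Qed.

Lemma wedge_one_forms m (c : 'I_m -> 'I_n -> B) (S : {set 'I_n}) :
  (\big[@wedge B n/form_one B n]_(k < m) one_form (c k)) S
  = \sum_(s : {ffun 'I_m -> 'I_n}) (\prod_(k < m) c k (s k)) *~ wedge_coef (values s) S.
Proof.
elim: m c S => [|m IH] c S.
  have emptyE (s : {ffun 'I_0 -> 'I_n}) : values s = [::].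
    by apply: size0nil; rewrite size_values.
  rewrite big_ord0 ffunE (eq_bigr (fun=> (S == finset.set0)%:R)).
    by rewrite sumr_const card_ffun !card_ord expn0 mulr1n.
  by move=> s _; rewrite big_ord0 emptyE /= mulrz_nat.
rewrite big_ord_recl wedge_one_form (big_insert ord0) big_mkcond.
apply: eq_bigr => v _; case: ifP => vS; last first.
  by rewrite big1 // => s _; rewrite values_insert0 /= vS mulr0z.
rewrite IH mulr_sumr mulr_sumr; apply: eq_bigr => s _.
rewrite values_insert0 /= vS big_ord_recl insert_at.
under [in RHS]eq_bigr => k _ do rewrite insert_lift.
by rewrite -[RHS]mulrzl rmorphM rmorphXn rmorphN1 /= -mulrzl; ring.
Qed.

End WedgeExpansion.

(** * Derivatives in several slots *)
Section SlotDerivatives.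
Variables (K : comNzRingType) (n : nat).

Definition deriv_seq N (ts : seq 'I_N) (F : mpoly N K) : mpoly N K :=
  foldr (@mderiv N K) F ts.

Lemma deriv_seq_linear N (ts : seq 'I_N) : linear (deriv_seq ts).
Proof. by move=> c F G; elim: ts => //= t ts ->; rewrite linearP. Qed.

HB.instance Definition _ N (ts : seq 'I_N) :=
  GRing.isLinear.Build K (mpoly N K) (mpoly N K) _ (deriv_seq ts) (@deriv_seq_linear N ts).

Lemma deriv_seq_perm N (ts ts' : seq 'I_N) F :
  perm_eq ts ts' -> deriv_seq ts F = deriv_seq ts' F.
Proof. exact: mderiv_perm. Qed.

Lemma mderiv_pure_tensor m (k : 'I_m.+1) v (g : 'I_m.+1 -> mpoly n K) :
  mderiv (slot_var k v) (pure_tensor g)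
  = pure_tensor (fun j => if j == k then mderiv v (g j) else g j).
Proof.
have dead j w : j != k -> mderiv (slot_var k v) (in_slot j w) = 0 :> tensor K n m.
  move=> jk; rewrite in_slotE mderiv_rename big1 // => u /eqP /slot_var_inj[jk' _].
  by rewrite jk' eqxx in jk.
rewrite /pure_tensor (bigD1 k) //= [in RHS](bigD1 k) //= eqxx mderivM.
have -> : mderiv (slot_var k v) (\prod_(j < m.+1 | j != k) in_slot j (g j)) = 0.
  pose flat (G : tensor K n m) := mderiv (slot_var k v) G = 0.
  apply: (big_ind flat) => [|G1 G2 d1 d2|j jk]; rewrite /flat; last exact: dead.
  - by rewrite -mpolyC1 mderivC.
  - by rewrite mderivM d1 d2 mul0r mulr0 addr0.
rewrite mulr0 addr0; congr (_ * _).
  by rewrite in_slotE mderiv_rename_inj // => u /slot_var_inj[].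
by apply: eq_bigr => j /negbTE ->.
Qed.

Definition slot_seq m (s : {ffun 'I_m -> 'I_n}) : seq 'I_(m.+1 * n) :=
  [seq slot_var (lift ord0 k) (s k) | k <- enum 'I_m].

Lemma deriv_slot_seq m (s : {ffun 'I_m -> 'I_n}) (g : 'I_m.+1 -> mpoly n K) :
  deriv_seq (slot_seq s) (pure_tensor g)
  = in_slot ord0 (g ord0)
    * \prod_(k < m) in_slot (lift ord0 k) (mderiv (s k) (g (lift ord0 k))).
Proof.
pose g' (ks : seq 'I_m) j :=
  if unlift ord0 j is Some k then if k \in ks then mderiv (s k) (g j) else g j else g j.
have partial (ks : seq 'I_m) : uniq ks ->
    deriv_seq [seq slot_var (lift ord0 k) (s k) | k <- ks] (pure_tensor g)
    = pure_tensor (g' ks).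
  elim: ks => [_|k ks IH] /=.
    by congr pure_tensor; apply: funext => j; rewrite /g'; case: unlift.
  move=> /andP[kks uks]; rewrite IH // mderiv_pure_tensor; congr pure_tensor.
  apply: funext => j; rewrite /g'; case: unliftP => [k'|] ->.
    rewrite (inj_eq lift_inj) in_cons; case: eqVneq => [->|//] /=.
    by rewrite (negbTE kks).
  by rewrite (negbTE (neq_lift _ _)).
rewrite partial ?enum_uniq // /pure_tensor big_ord_recl /g' unlift_none.
by congr (_ * _); apply: eq_bigr => k _; rewrite liftK mem_enum.
Qed.

Lemma pure_tensor_mnm m (mu : multinom (m.+1 * n)) :
  pure_tensor (fun k => mpolyX K (slot_mnm mu k)) = mpolyX K mu.
Proof.
rewrite [RHS]mpolyXE_id (reindex _ (curry_mxvec_bij _ _)) /=.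
rewrite (eq_bigr (fun p : 'I_m.+1 * 'I_n =>
    mpolyX K (mnm1 (slot_var p.1 p.2)) ^+ mu (slot_var p.1 p.2))); last by case.
rewrite -(pair_bigA _ (fun k v => mpolyX K (mnm1 (slot_var k v)) ^+ mu (slot_var k v))) /=.
apply: eq_bigr => k _; rewrite in_slotE renameX_prod; apply: eq_bigr => v _.
by rewrite /slot_mnm mnmE.
Qed.

(** Chains are linear combinations of pure tensors of monomials. *)
Lemma linear_ext_linear m (V : lmodType K) (phi : ('I_m.+1 -> mpoly n K) -> V)
    (L : {linear tensor K n m -> V}) F :
  (forall a, phi a = L (pure_tensor a)) -> linear_ext phi F = L F.
Proof.
move=> phiE; rewrite /linear_ext [in RHS](mpolyE F) linear_sum.
by apply: eq_bigr => mu _; rewrite linearZ /= phiE pure_tensor_mnm.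
Qed.

End SlotDerivatives.

(** * The quantum HKR map and the Hochschild differential on chains *)
Lemma ffun_scaleD (K : nzRingType) (T : finType) (V : lmodType K) c (f g : {ffun T -> V}) x :
  (c *: f + g) x = c *: f x + g x.
Proof. by rewrite !ffunE. Qed.

Lemma ffun_scaleE (K : nzRingType) (T : finType) (V : lmodType K) c (f : {ffun T -> V}) x :
  (c *: f) x = c *: f x.
Proof. by rewrite ffunE. Qed.

Lemma ffun_sumB (T : finType) (V : zmodType) n (f g : 'I_n -> {ffun T -> V}) x :
  (\sum_(i < n) (f i - g i)) x = \sum_(i < n) (f i x - g i x).
Proof. by rewrite sum_ffunE; apply: eq_bigr => i _; rewrite !ffunE. Qed.

Lemma scale_sum_mulrz (K : nzRingType) (V : lmodType K) (c : K) (I J : finType) n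
    (A B : 'I_n -> I -> J -> V) (e : I -> J -> int) :
  \sum_l \sum_s (c *: \sum_(i < n) (A i l s - B i l s)) *~ e l s
  = c *: \sum_(i < n) (\sum_l \sum_s A i l s *~ e l s - \sum_l \sum_s B i l s *~ e l s).
Proof.
under [in RHS]eq_bigr => i _.
  rewrite -sumrB.
  under eq_bigr => l _ do (rewrite -sumrB; under eq_bigr => s _ do rewrite -mulrzBl).
  over.
rewrite [in RHS]exchange_big [RHS]scaler_sumr; apply: eq_bigr => l _ /=.
rewrite [in RHS]exchange_big [RHS]scaler_sumr; apply: eq_bigr => s _ /=.
by rewrite scalerMzr mulrz_suml.
Qed.

Lemma signed_sum_mulrz (K : pzRingType) (J : finType) (k : nat) (x : J -> K) (e : J -> int) :
  (-1) ^+ k * (\sum_s x s *~ e s) = \sum_s x s *~ ((-1) ^+ k * e s).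
Proof.
rewrite mulr_sumr; apply: eq_bigr => s _.
rewrite mulrzAr mulrzA; congr (_ *~ _).
by rewrite -[RHS]mulrzl rmorphXn rmorphN1.
Qed.

Lemma scale_sign (K : nzRingType) (V : lmodType K) (l : nat) (v : V) :
  (-1) ^+ l *: v = v *~ ((-1) ^+ l).
Proof. by rewrite -scaler_int rmorphXn rmorphN1. Qed.

(** The kernel of slot_op is supported on the row and the column of k0, and
    each of the two gives a sum over all slots. *)
Lemma pick_slot (K : comNzRingType) n q m (k0 : 'I_m.+1) (x p : 'I_q -> 'I_n)
    (G : tensor K n m) :
  \sum_(k < m.+1) \sum_(l < m.+1) \sum_(i < q)
     ((l == k0)%:R - (k == k0)%:R) *: mderiv (slot_var k (x i)) (mderiv (slot_var l (p i)) G)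
  = \sum_(i < q) (\sum_(k < m.+1) mderiv (slot_var k (x i)) (mderiv (slot_var k0 (p i)) G)
     - \sum_(k < m.+1) mderiv (slot_var k (p i)) (mderiv (slot_var k0 (x i)) G)).
Proof.
under eq_bigr => k _ do rewrite exchange_big.
rewrite exchange_big; apply: eq_bigr => i _ /=.
under eq_bigr => k _ do (under eq_bigr => l _ do rewrite scalerBl; rewrite sumrB).
rewrite sumrB; congr (_ - _).
  apply: eq_bigr => k _; rewrite (bigD1 k0) //= eqxx scale1r big1 ?addr0 //.
  by move=> l /negbTE ->; rewrite scale0r.
rewrite (bigD1 k0) //= [X in _ + X]big1 ?addr0 => [|k /negbTE kk0].
  by apply: eq_bigr => l _; rewrite eqxx scale1r mderiv_comm.
by rewrite big1 // => l _; rewrite kk0 scale0r.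
Qed.

Section Assembly.
Variables (R : realType) (r : nat).
Local Notation N := (r + r)%N.

(** The tensor f_0 (x) ... (x) f_m enters only through derivatives in the slots
    1, ..., m; this is what extends sigma to all chains. *)
Lemma pre_form_expansion m (f : 'I_m.+1 -> polAh R r) S :
  pre_form f S = \sum_(s : {ffun 'I_m -> 'I_N})
    deriv_seq (slot_seq s) (pure_tensor f) *~ wedge_coef (values s) S.
Proof.
rewrite /pre_form ffunE.
rewrite (wedge_one_forms (fun k v => in_slot (lift ord0 k) (mderiv v (f (lift ord0 k))))).
rewrite mulr_sumr; apply: eq_bigr => s _.
by rewrite deriv_slot_seq mulrzAr.
Qed.

Definition sigma_coef m (S : {set 'I_N}) (F : chain R r m) : polAh R r :=
  \sum_(s : {ffun 'I_m -> 'I_N})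
    slots_int (deriv_seq (slot_seq s) F) *~ wedge_coef (values s) S.

Lemma sigma_coef_linear m S : linear (@sigma_coef m S).
Proof.
move=> c F G; rewrite /sigma_coef scaler_sumr -big_split; apply: eq_bigr => s _ /=.
by rewrite linearP /= linearP /= mulrzDl scalerMzr.
Qed.

Definition sigma_op m (F : chain R r m) : formAh R r := [ffun S => sigma_coef S F].

Lemma sigma_opE m (F : chain R r m) S : sigma_op F S = sigma_coef S F.
Proof. exact: ffunE. Qed.

Lemma sigma_op_linear m : linear (@sigma_op m).
Proof.
move=> c F G; apply/ffunP => S.
apply: etrans (sigma_opE _ _) _; apply: etrans (sigma_coef_linear _ _ _ _) _.
apply: esym; apply: etrans (ffun_scaleD _ _ _ _) _.
exact: (congr2 (fun x y => c *: x + y) (sigma_opE F S) (sigma_opE G S)).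
Qed.

HB.instance Definition _ m :=
  GRing.isLinear.Build (Ch R) (chain R r m) (formAh R r) _
    (@sigma_op m) (@sigma_op_linear m).

Lemma sigmaE m (F : chain R r m) : sigma F = sigma_op F.
Proof.
apply: linear_ext_linear => a; apply/ffunP => S; rewrite !ffunE.
have -> : mpoly_integral (torus_measure R m.+1) (@cyc R m)
    (fun th => sigma_integrand a th S) = slots_int (pre_form a S).
  by congr mpoly_integral; apply: funext => th; rewrite ffunE.
rewrite pre_form_expansion linear_sum; apply: eq_bigr => s _.
exact: raddfMz.
Qed.

(** The k-th term of the Hochschild differential: the slot k times the next one,
    in cyclic order. *)
Definition merge_face m (k : 'I_m.+2) : chain R r m.+1 -> chain R r m :=
  if unlift ord_max k is Some j then merge_slot j else @merge_wrap R r m.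

Lemma merge_face_linear m (k : 'I_m.+2) : linear (@merge_face m k).
Proof. by rewrite /merge_face; case: unlift => [j|]; apply: merge_linear. Qed.

HB.instance Definition _ m (k : 'I_m.+2) :=
  GRing.isLinear.Build (Ch R) (chain R r m.+1) (chain R r m) _
    (merge_face k) (@merge_face_linear m k).

Lemma merge_face_lift m (j : 'I_m.+1) : merge_face (lift ord_max j) = merge_slot j.
Proof. by rewrite /merge_face liftK. Qed.

Lemma merge_face_max m : @merge_face m ord_max = @merge_wrap R r m.
Proof. by rewrite /merge_face unlift_none. Qed.

Definition hochschild_op m (F : chain R r m.+1) : chain R r m :=
  \sum_(k < m.+2) (-1) ^+ k *: merge_face k F.

Lemma hochschild_op_linear m : linear (@hochschild_op m).
Proof.
move=> c F G; rewrite /hochschild_op scaler_sumr -big_split; apply: eq_bigr => k _ /=.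
by rewrite merge_face_linear scalerDr !scalerA [c * _]mulrC.
Qed.

HB.instance Definition _ m :=
  GRing.isLinear.Build (Ch R) (chain R r m.+1) (chain R r m) _
    (@hochschild_op m) (@hochschild_op_linear m).

Lemma merge_at_pure m (a : 'I_m.+2 -> polAh R r) (k : 'I_m.+1) :
  pure_tensor (merge_at a k) = merge_slot k (pure_tensor a) :> chain R r m.
Proof.
have kE : lift (lift ord0 k) k = widen_ord (leqnSn _) k :> 'I_m.+2.
  by apply: ord_inj; rewrite -[LHS]/(bump (lift ord0 k) k) lift0 /bump ltnn.
apply: esym; apply: pure_tensor_merge; first by left.
  by rewrite /merge_at ltnn eqxx kE.
move=> j jk; rewrite /merge_at (negbTE jk).
have {}jk : j != k :> nat by [].
case: ltnP => h; congr (a _); apply: ord_inj;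
  rewrite -[RHS]/(bump (lift ord0 k) j) !lift0 /bump;
  by case: (leqP k.+1 j) => h2; rewrite /= ?add1n ?add0n; lia.
Qed.

Lemma merge_last_pure m (a : 'I_m.+2 -> polAh R r) :
  pure_tensor (merge_last a) = merge_wrap (pure_tensor a) :> chain R r m.
Proof.
have zE : lift ord_max ord0 = ord0 :> 'I_m.+2 by apply: val_inj.
apply: esym; apply: pure_tensor_merge; first by right.
  by rewrite /merge_last eqxx.
move=> j j0; rewrite /merge_last (negbTE j0); congr (a _).
by apply: ord_inj; rewrite lift_max.
Qed.

Lemma hochschildE m (F : chain R r m.+1) : hochschild F = hochschild_op F.
Proof.
apply: linear_ext_linear => a; rewrite /hochschild_pure /= /hochschild_op.
rewrite [in RHS]big_ord_recr /= merge_face_max merge_last_pure; congr (_ + _).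
apply: eq_bigr => k _; rewrite merge_at_pure -merge_face_lift.
by congr (_ *: merge_face _ _); apply: ord_inj; rewrite lift_max.
Qed.

Definition skip_seq m (l : 'I_m.+1) (s : {ffun 'I_m -> 'I_N}) : seq 'I_(m.+2 * N) :=
  [seq slot_var (lift ord0 (lift l k)) (s k) | k <- enum 'I_m].

Lemma perm_enum_lift m (l : 'I_m.+1) :
  perm_eq (enum 'I_m.+1) (l :: [seq lift l k | k <- enum 'I_m]).
Proof.
apply: uniq_perm; first exact: enum_uniq.
  rewrite /= (map_inj_uniq (@lift_inj _ l)) enum_uniq andbT.
  by apply/mapP => -[k _ /eqP]; rewrite (negbTE (neq_lift _ _)).
move=> i; rewrite mem_enum in_cons; case: (unliftP l i) => [k|] ->; last by rewrite eqxx.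
by rewrite map_f ?orbT // mem_enum.
Qed.

Lemma slot_seq_insert m (l : 'I_m.+1) v (s : {ffun 'I_m -> 'I_N}) :
  perm_eq (slot_seq (insert l v s)) (slot_var (lift ord0 l) v :: skip_seq l s).
Proof.
have -> : slot_var (lift ord0 l) v :: skip_seq l s
    = [seq slot_var (lift ord0 k) (insert l v s k)
        | k <- l :: [seq lift l k | k <- enum 'I_m]].
  rewrite /= insert_at -map_comp; congr (_ :: _); apply: eq_map => k /=.
  by rewrite insert_lift.
exact/perm_map/perm_enum_lift.
Qed.

Lemma deriv_seq_merge m (M : {linear chain R r m.+1 -> chain R r m})
    (s : {ffun 'I_m -> 'I_N}) (t : 'I_m -> 'I_m.+2) (ks : seq 'I_m) F :
  (forall k v G, k \in ks ->
     mderiv (slot_var (lift ord0 k) v) (M G) = M (mderiv (slot_var (t k) v) G)) ->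
  deriv_seq [seq slot_var (lift ord0 k) (s k) | k <- ks] (M F)
  = M (deriv_seq [seq slot_var (t k) (s k) | k <- ks] F).
Proof.
elim: ks => //= k ks IH Mt; rewrite IH => [|k' v G k'ks].
  by rewrite Mt // mem_head.
by apply: Mt; rewrite in_cons k'ks orbT.
Qed.

(** The Leibniz rule. When the slots k and k + 1 are multiplied, the derivative
    of the product falls on one of them, and the other one, k + 1 or k, has none.
    The slot 0 never carries a derivative, which leaves a single possibility
    when it is one of the two factors. *)
Lemma deriv_merge_face m (k : 'I_m.+2) (s : {ffun 'I_m -> 'I_N}) F :
  deriv_seq (slot_seq s) (merge_face k F)
  = oapp (fun l => merge_face k (deriv_seq (skip_seq l s) F)) 0 (unlift ord_max k)
    + oapp (fun l => merge_face k (deriv_seq (skip_seq l s) F)) 0 (unlift ord0 k).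
Proof.
case: (unliftP ord_max k) => [l|] -> /=; last first.
  have -> : ord_max = lift ord0 ord_max :> 'I_m.+2 by apply: val_inj.
  rewrite liftK /= add0r.
  have -> : lift ord0 ord_max = ord_max :> 'I_m.+2 by apply: val_inj.
  apply: (@deriv_seq_merge _ _ s (fun k => lift ord0 (lift ord_max k))) => j v G _.
  rewrite /= merge_face_max mderiv_merge.
  rewrite (big_pred1 (lift ord_max (lift ord0 j))) => [|i] /=.
    by rewrite lift_max0.
  case: (unliftP ord_max i) => [i'|] ->; last first.
    by rewrite collapse_removed (negbTE (neq_lift _ _)) (negbTE (neq_lift _ _)).
  by rewrite collapse_lift (inj_eq lift_inj).
have step j v G : mderiv (slot_var (lift ord0 j) v) (merge_face (lift ord_max l) G)
    = merge_face (lift ord_max l) (mderiv (slot_var (lift ord0 (lift l j)) v) G)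
      + (if l == lift ord0 j
         then merge_face (lift ord_max l) (mderiv (slot_var (lift ord0 l) v) G) else 0).
  rewrite merge_face_lift mderiv_merge big_mkcond (bigD1_ord (lift ord0 l)) //=.
  rewrite collapse_removed addrC; congr (_ + _).
  under eq_bigr => i _ do rewrite collapse_lift.
  by rewrite -big_mkcond big_pred1_eq lift_lift0.
case: (unliftP ord0 l) => [j|] lE; last first.
  have -> : lift ord_max l = ord0 :> 'I_m.+2 by apply: val_inj; rewrite lE.
  rewrite unlift_none /= addr0.
  have -> : ord0 = lift ord_max l :> 'I_m.+2 by apply: val_inj; rewrite lE.
  apply: (@deriv_seq_merge _ _ s (fun k => lift ord0 (lift l k))) => j v G _.
  by rewrite /= step lE (negbTE (neq_lift _ _)) addr0.
have lE' : lift ord_max l = lift ord0 (lift ord_max j) by rewrite lE lift_max0.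
have -> : unlift ord0 (lift ord_max l) = Some (lift ord_max j) by rewrite lE' liftK.
rewrite /=.
have perm_j : perm_eq (enum 'I_m) (j :: rem j (enum 'I_m)).
  by apply: perm_to_rem; rewrite mem_enum.
have rem_j k' : k' \in rem j (enum 'I_m) -> k' != j.
  by rewrite mem_rem_uniq ?enum_uniq // => /andP[].
rewrite /slot_seq (deriv_seq_perm _ (perm_map _ perm_j)) /=.
rewrite (@deriv_seq_merge _ _ s (fun k => lift ord0 (lift l k))); last first.
  move=> k' v G /rem_j k'j; rewrite /= step lE (inj_eq lift_inj) eq_sym (negbTE k'j).
  by rewrite addr0.
rewrite step -lE eqxx; apply: (congr2 (fun G1 G2 => merge_face _ G1 + merge_face _ G2)).
  exact: esym (deriv_seq_perm _ (perm_map _ perm_j)).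
apply: esym; apply: etrans (deriv_seq_perm _ (perm_map _ perm_j)) _.
rewrite /= lift_max_self -lE; congr (mderiv _ (deriv_seq _ F)).
by apply/eq_in_map => k' /rem_j k'j; rewrite lift_max_lift0 // -lE.
Qed.

Lemma next_mergeE m (l : 'I_m.+1) : @next_merge R r m l = merge_face (lift ord0 l).
Proof.
rewrite /next_merge; case: (unliftP ord_max l) => [j|] ->.
  rewrite -merge_face_lift; congr merge_face.
  by rewrite lift_max0.
by rewrite -merge_face_max; congr merge_face; apply: val_inj.
Qed.

(** The terms of the Leibniz rule are collected according to the slot l + 1
    without derivative. There are two of them, with opposite signs: this slot
    times its left or its right neighbour. They are the boundary terms of the
    Stokes formula in the direction u_l. *)
Lemma sigma_coef_hochschild m (F : chain R r m.+1) S :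
  sigma_coef S (hochschild_op F)
  = \sum_(l < m.+1) \sum_(s : {ffun 'I_m -> 'I_N})
      slots_int (gap_op l (deriv_seq (skip_seq l s) F))
      *~ ((-1) ^+ l * wedge_coef (values s) S).
Proof.
rewrite exchange_big; apply: eq_bigr => s _ /=.
transitivity ((\sum_(l < m.+1) slots_int (gap_op l (deriv_seq (skip_seq l s) F))
    *~ ((-1) ^+ l)) *~ wedge_coef (values s) S); last first.
  by rewrite mulrz_suml; apply: eq_bigr => l _; rewrite mulrzA.
congr (_ *~ _).
pose term k l := slots_int (merge_face k (deriv_seq (skip_seq l s) F)).
have faceE (k : 'I_m.+2) :
    slots_int (deriv_seq (slot_seq s) ((-1) ^+ k *: merge_face k F))
    = (oapp (term k) 0 (unlift ord_max k) + oapp (term k) 0 (unlift ord0 k))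
      *~ ((-1) ^+ k).
  rewrite linearZ linearZ /= deriv_merge_face linearD /= scale_sign.
  by congr ((_ + _) *~ _); case: unlift => [l|] //=; rewrite linear0.
rewrite /hochschild_op linear_sum linear_sum (eq_bigr _ (fun k _ => faceE k)).
under eq_bigr => k _ do rewrite mulrzDl.
rewrite big_split /= (bigD1_ord ord_max) //= unlift_none mul0rz add0r.
rewrite [X in _ + X](bigD1_ord ord0) //= unlift_none mul0rz add0r -big_split.
apply: eq_bigr => l _ /=; rewrite !liftK /= /bump leq0n add1n leqNgt ltn_ord add0n.
have stokesE : slots_int (gap_op l (deriv_seq (skip_seq l s) F))
    = term (lift ord_max l) l - term (lift ord0 l) l.
  apply: etrans (slots_int_stokes _ _) _.
  by rewrite next_mergeE /term merge_face_lift.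
rewrite stokesE; move: (term _ _) (term _ _) => x y.
by rewrite exprS mulN1r mulrNz mulrzBl.
Qed.

(** By the antiderivation property, the sum is again over a distinguished slot
    l + 1, which now carries the derivative in the direction v, and the signs
    are those of sigma_coef_hochschild. *)
Lemma contraction_sigma m v (F : chain R r m.+1) S :
  contraction v (sigma_op F) S
  = \sum_(l < m.+1) \sum_(s : {ffun 'I_m -> 'I_N})
      slots_int (mderiv (slot_var (lift ord0 l) v) (deriv_seq (skip_seq l s) F))
      *~ ((-1) ^+ l * wedge_coef (values s) S).
Proof.
have coefE (s : {ffun 'I_m.+1 -> 'I_N}) :
    (if v \in S then 0 else (-1) ^+ count_below v S * wedge_coef (values s) (v |: S))
    = \sum_(l < m.+1) (s l == v)%:R
        * ((-1) ^+ l * wedge_coef (remove_at l (values s)) S).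
  rewrite (contraction_wedge_coef _ _ _ v) size_values.
  by apply: eq_bigr => l _; rewrite nth_values.
transitivity (\sum_(s : {ffun 'I_m.+1 -> 'I_N}) slots_int (deriv_seq (slot_seq s) F)
    *~ (if v \in S then 0
        else (-1) ^+ count_below v S * wedge_coef (values s) (v |: S))).
  apply: etrans (ffunE _ _) _; case: ifP => vS.
    by rewrite big1 // => s _; rewrite mulr0z.
  rewrite sigma_opE.
  exact: signed_sum_mulrz.
under eq_bigr => s _ do rewrite coefE mulrz_sumr.
rewrite exchange_big; apply: eq_bigr => l _ /=.
rewrite (big_insert l) (bigD1 v) //= [X in _ + X]big1 ?addr0 => [|u /negbTE uv].
  apply: eq_bigr => s _; rewrite insert_at eqxx mul1r remove_at_insert.
  by rewrite (deriv_seq_perm _ (slot_seq_insert l v s)).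
by rewrite big1 // => s _; rewrite insert_at uv mul0r mulr0z.
Qed.

(** In gap_op l, a derivative in the slot l + 1 is paired with the sum over all
    slots of the conjugate derivative, which is a total derivative after the
    integration. *)
Lemma gap_op_slots_int m (l : 'I_m.+1) (G : chain R r m.+1) :
  slots_int (gap_op l G)
  = ihbar R *: \sum_(i < r)
     (mderiv (xvar i) (slots_int (mderiv (slot_var (lift ord0 l) (pvar i)) G))
      - mderiv (pvar i) (slots_int (mderiv (slot_var (lift ord0 l) (xvar i)) G))).
Proof.
have coefE k k' : (((k' == lift ord0 l)%:R - (k == lift ord0 l)%:R : R)%:C%C)%:P
    = (k' == lift ord0 l)%:R - (k == lift ord0 l)%:R :> Ch R.
  by rewrite !rmorphB !rmorph_nat.
have -> : gap_op l G = ihbar R *: \sum_(i < r)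
    (\sum_(k < m.+2) mderiv (slot_var k (xvar i))
        (mderiv (slot_var (lift ord0 l) (pvar i)) G)
     - \sum_(k < m.+2) mderiv (slot_var k (pvar i))
        (mderiv (slot_var (lift ord0 l) (xvar i)) G)).
  rewrite /gap_op /slot_op /bidiff; congr (_ *: _).
  under eq_bigr => k _ do under eq_bigr => k' _ do under eq_bigr => i _ do
    rewrite coefE.
  exact: pick_slot.
rewrite linearZ linear_sum; congr (_ *: _); apply: eq_bigr => i _ /=.
by rewrite linearB /= !mderiv_slots_int.
Qed.

Lemma sigma_hochschildS m (F : chain R r m.+1) :
  sigma_op (hochschild_op F) = ihbar R *: Delta (sigma_op F).
Proof.
apply/ffunP => S; apply: etrans (sigma_opE _ _) _.
apply: esym; apply: etrans (ffun_scaleE _ _ _) _.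
apply: esym; apply: etrans (sigma_coef_hochschild _ _) _.
under eq_bigr => l _ do under eq_bigr => s _ do rewrite gap_op_slots_int.
apply: etrans (scale_sum_mulrz _ _ _ _) _; congr (_ *: _).
apply: esym; apply: etrans (ffun_sumB _ _ _) _; apply: eq_bigr => i _.
have derivE (v w : 'I_N) : coef_deriv v (contraction w (sigma_op F)) S
    = \sum_(l < m.+1) \sum_(s : {ffun 'I_m -> 'I_N})
        mderiv v (slots_int (mderiv (slot_var (lift ord0 l) w) (deriv_seq (skip_seq l s) F)))
        *~ ((-1) ^+ l * wedge_coef (values s) S).
  apply: etrans (ffunE _ _) _; rewrite contraction_sigma.
  apply: etrans (raddf_sum (mderiv v) _ _ _) _; apply: eq_bigr => l _ /=.
  apply: etrans (raddf_sum (mderiv v) _ _ _) _; apply: eq_bigr => s _ /=.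
  exact: raddfMz.
exact: (congr2 (fun x y => x - y) (derivE _ _) (derivE _ _)).
Qed.

Lemma contraction_sigma0 v (F : chain R r 0) S : contraction v (sigma_op F) S = 0.
Proof.
apply: etrans (ffunE _ _) _; case: ifP => // _.
suff -> : sigma_op F (v |: S) = 0 by rewrite mulr0.
apply: etrans (sigma_opE _ _) _; apply: big1 => s _.
have -> : values s = [::] by apply: size0nil; rewrite size_values.
have -> : wedge_coef [::] (v |: S) = 0; last exact: mulr0z.
rewrite /=; suff -> : (v |: S == finset.set0) = false by [].
by apply/negbTE/finset.set0Pn; exists v; rewrite finset.setU11.
Qed.

Lemma Delta_sigma0 (F : chain R r 0) : Delta (sigma_op F) = 0.
Proof.
apply/ffunP => S; rewrite [RHS]ffunE; apply: etrans (ffun_sumB _ _ _) _.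
have derivE v w : coef_deriv v (contraction w (sigma_op F)) S = 0.
  by apply: etrans (ffunE _ _) _; rewrite contraction_sigma0 raddf0.
apply: big1 => i _.
apply: etrans (congr2 (fun x y => x - y) (derivE _ _) (derivE _ _)) _; exact: subrr.
Qed.

End Assembly.

Theorem proposition3p6 (R : realType) (r m : nat) (f : 'I_m.+1 -> polA R r) :
  let ftens : chain R r m := pure_tensor (fun k => polA_inj (f k)) in
  sigma (hochschild ftens) = ihbar R *: Delta (sigma ftens).
Proof.
case: m f => [|m] f F; last by rewrite hochschildE !sigmaE sigma_hochschildS.
by rewrite !sigmaE Delta_sigma0 scaler0 linear0.
Qed.
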